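(* Let $(\mathcal C,\otimes)$ be a $K$-linear Gray semigroup. Then the $\psi$-equivalence classes of first order unitary (tensorator,associator)-deformations of $(\mathcal C,\otimes)$ are in bijection with the elements of the group $H^2_{tens,ass}(\mathcal C)$.
   Context: Conventions. $K$ is a commutative ring with unit. In a (strict) 2-category, $id_X$ is the identity 1-morphism, $1_f$ the identity 2-morphism, $\sigma\cdot\tau$ the vertical composite (first $\tau$), and $\circ$ denotes composition of 1-morphisms ($g\circ f$: first $f$) and horizontal composition of 2-morphisms. A 2-category is $K$-linear if its sets of 2-morphisms are $K$-modules and vertical and horizontal composition are $K$-bilinear. Gray semigroup. A Gray semigroup $(\mathcal C,\otimes)$ is a 2-category $\mathcal C$ with objects $X\otimes Y$, functors $\mathcal C(X,X')\times\mathcal C(Y,Y')\to\mathcal C(X\otimes Y,X'\otimes Y')$ written $(f,g)\mapsto f\otimes g$, $(\tau,\sigma)\mapsto\tau\otimes\sigma$, and 2-isomorphisms $\widehat\otimes((f',g'),(f,g)):(f'\otimes g')\circ(f\otimes g)\Rightarrow(f'\circ f)\otimes(g'\circ g)$, natural in all arguments, such that: $id_X\otimes id_Y=id_{X\otimes Y}$; $\widehat\otimes((f'',g''),(f'\circ f,g'\circ g))\cdot(1_{f''\otimes g''}\circ\widehat\otimes((f',g'),(f,g)))=\widehat\otimes((f''\circ f',g''\circ g'),(f,g))\cdot(\widehat\otimes((f'',g''),(f',g'))\circ1_{f\otimes g})$; $\widehat\otimes((id,id),(f,g))$ and $\widehat\otimes((f,g),(id,id))$ are identities; (cubical) all $\widehat\otimes((f',id),(f,g))$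 and $\widehat\otimes((f,g'),(id,g))$ are identities; $\otimes$ is strictly associative on objects, 1-morphisms and 2-morphisms; and $(\widehat\otimes((f',g'),(f,g))\otimes1_{h'\circ h})\cdot\widehat\otimes((f'\otimes g',h'),(f\otimes g,h))=(1_{f'\circ f}\otimes\widehat\otimes((g',h'),(g,h)))\cdot\widehat\otimes((f',g'\otimes h'),(f,g\otimes h))$. It is $K$-linear if $\mathcal C$ is $K$-linear and $(\tau,\sigma)\mapsto\tau\otimes\sigma$ is $K$-bilinear. Deformations. Let $\mathcal C_\epsilon$ have the same objects and 1-morphisms as $\mathcal C$, with 2-morphisms $\tau_0+\tau_1\epsilon$ ($\tau_0,\tau_1$ parallel 2-morphisms of $\mathcal C$, $\epsilon^2=0$); vertical and horizontal compositions and $\otimes$ of 2-morphisms are extended $K[\epsilon]/(\epsilon^2)$-bilinearly. A first order unitary (tensorator,associator)-deformation consists of families $\widehat\otimes_\epsilon((f',g'),(f,g))=\widehat\otimes((f',g'),(f,g))+\widehat\otimes^{(1)}((f',g'),(f,g))\epsilon$ and $\widehat a_\epsilon(f,g,h)=1_{f\otimes g\otimes h}+\widehat a^{(1)}(f,g,h)\epsilon$ of 2-isomorphisms of $\mathcal C_\epsilon$ (all other structure, including $id_X\otimes id_Y=id_{X\otimes Y}$, the identity associator 1-morphisms and the trivial pentagonator, being unchanged) that define a semigroupal structure on $\mathcal C_\epsilon$, i.e. (1) $\widehat\otimes_\epsilon$ is natural, satisfies the same cocycle identity as $\widehat\otimes$ above, and $\widehat\otimes_\epsilon((id,id),(f,g))$,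 $\widehat\otimes_\epsilon((f,g),(id,id))$ are identities; (2) $\widehat a_\epsilon$ is natural, $\widehat a_\epsilon(id_X,id_Y,id_Z)$ is the identity, and $\widehat a_\epsilon(f'f,g'g,h'h)\cdot(\widehat\otimes_\epsilon((f',g'),(f,g))\otimes1_{h'h})\cdot\widehat\otimes_\epsilon((f'\otimes g',h'),(f\otimes g,h))=(1_{f'f}\otimes\widehat\otimes_\epsilon((g',h'),(g,h)))\cdot\widehat\otimes_\epsilon((f',g'\otimes h'),(f,g\otimes h))\cdot(\widehat a_\epsilon(f',g',h')\circ1_{f\otimes g\otimes h})\cdot(1_{f'\otimes g'\otimes h'}\circ\widehat a_\epsilon(f,g,h))$; (3) $\widehat a_\epsilon(f,g,h\otimes k)\cdot\widehat a_\epsilon(f\otimes g,h,k)=(1_f\otimes\widehat a_\epsilon(g,h,k))\cdot\widehat a_\epsilon(f,g\otimes h,k)\cdot(\widehat a_\epsilon(f,g,h)\otimes1_k)$. $\psi$-equivalence. Two such deformations $(\widehat\otimes_\epsilon,\widehat a_\epsilon)$ and $(\widehat\otimes'_\epsilon,\widehat a'_\epsilon)$ are $\psi$-equivalent if the identity 2-functor of $\mathcal C_\epsilon$ admits a semigroupal structure $(\psi,\omega)$ with $\psi_{X,Y}=id_{X\otimes Y}$, $\widehat\psi(f,g)$ the identity mod $\epsilon$, and $\omega$ trivial; explicitly, there are 2-isomorphisms $\widehat\psi(f,g)=1_{f\otimes g}+\widehat\psi^{(1)}(f,g)\epsilon$, natural in $(f,g)$, with $\widehat\psi(id,id)=1$,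 $\widehat\psi(f'f,g'g)\cdot\widehat\otimes_\epsilon((f',g'),(f,g))=\widehat\otimes'_\epsilon((f',g'),(f,g))\cdot(\widehat\psi(f',g')\circ1_{f\otimes g})\cdot(1_{f'\otimes g'}\circ\widehat\psi(f,g))$, and $(1_f\otimes\widehat\psi(g,h))\cdot\widehat\psi(f,g\otimes h)\cdot\widehat a_\epsilon(f,g,h)=\widehat a'_\epsilon(f,g,h)\cdot(\widehat\psi(f,g)\otimes1_h)\cdot\widehat\psi(f\otimes g,h)$. Double complex. For $m,n\ge1$ let $X^{m-1,n-1}(\mathcal C)$ be the $K$-module of families $\phi$ of 2-morphisms $\phi(f_0,\dots,f_{m-1}):T_0\circ\cdots\circ T_{m-1}\Rightarrow c^1\otimes\cdots\otimes c^n$, one for each sequence of composable $n$-tuples $f_j=(f_j^1,\dots,f_j^n)$ of 1-morphisms ($f_{m-1}$ applied first), where $T_j=f_j^1\otimes\cdots\otimes f_j^n$ and $c^k=f_0^k\circ\cdots\circ f_{m-1}^k$, natural with respect to 2-morphisms in all $f_j^k$. Composites $f_{j-1}\circ f_j$ are componentwise. For pairs $p_j=(f_j,g_j)$ put $\Theta_2(p_0)=1$, $\Theta_2(p_0,\dots,p_{m-1})=\widehat\otimes(p_0,p_1\circ\cdots\circ p_{m-1})\cdot(1_{f_0\otimes g_0}\circ\Theta_2(p_1,\dots,p_{m-1}))$. Put $\Theta_1=1$ and $\Theta_n((f_j^1,\dots,f_j^n)_j)=(1_{c^1}\otimes\Theta_{n-1}((f_j^2,\dots,f_j^n)_j))\cdot\Theta_2((f_j^1,f_j^2\otimes\cdots\otimes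 f_j^n)_j)$ for $n\geq 3$. Define $\delta_h:X^{m-1,n-1}(\mathcal C)\to X^{m,n-1}(\mathcal C)$ by $$(\delta_h\phi)(f_0,\dots,f_m)=\Theta_n(f_0,f_1\circ\cdots\circ f_m)\cdot(1_{T_0}\circ\phi(f_1,\dots,f_m))+\sum_{i=1}^m(-1)^i\phi(\dots,f_{i-1}\circ f_i,\dots)\cdot(1\circ\Theta_n(f_{i-1},f_i)\circ1)+(-1)^{m+1}\Theta_n(f_0\circ\cdots\circ f_{m-1},f_m)\cdot(\phi(f_0,\dots,f_{m-1})\circ1_{T_m}),$$ where the outer $1$'s are identities of the remaining $T_j$'s. Define $\delta_v:X^{m-1,n-1}(\mathcal C)\to X^{m-1,n}(\mathcal C)$, for $f_j=(f_j^0,\dots,f_j^n)$, by $$(\delta_v\phi)(f_0,\dots,f_{m-1})=(1_{c^0}\otimes\phi((f_j^1,\dots,f_j^n)_j))\cdot\Theta_2((f_j^0,f_j^1\otimes\cdots\otimes f_j^n)_j)+\sum_{i=1}^n(-1)^i(1\otimes\Theta_2((f_j^{i-1},f_j^i)_j)\otimes1)\cdot\phi((f_j^0,\dots,f_j^{i-1}\otimes f_j^i,\dots,f_j^n)_j)+(-1)^{n+1}(\phi((f_j^0,\dots,f_j^{n-1})_j)\otimes1_{c^n})\cdot\Theta_2((f_j^0\otimes\cdots\otimes f_j^{n-1},f_j^n)_j),$$ where the outer $1$'s are identities of the remaining $c^k$'s. $\phi\in X^{m-1,n-1}(\mathcal C)$ is special if $\phi(f_0,\dots,f_{m-1})=0$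 whenever some $f_i=(id,\dots,id)$; the special elements form $X_s^{m-1,n-1}(\mathcal C)$, which is preserved by $\delta_h,\delta_v$. Total complex. $X^q_{tens,ass}(\mathcal C)=\bigoplus_{m+n=q,\,m\ge0,\,n\ge1}X_s^{m,n}(\mathcal C)$ for $q\ge1$, with coboundary $\delta_{tens,ass}=\bigoplus((-1)^n\delta_h+\delta_v)$; $H^\bullet_{tens,ass}(\mathcal C)$ denotes its cohomology. *)

(* Defs.v *)
From HB Require Import structures.
From mathcomp Require Import all_boot all_algebra.
From mathcomp Require Import boolp.

Set Implicit Arguments.
Unset Strict Implicit.
Unset Printing Implicit Defensive.

Import GRing.Theory.
Local Open Scope ring_scope.

Reserved Notation "g ∘ f" (at level 40, left associativity).
Reserved Notation "σ ∘₂ τ" (at level 40, left associativity).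
Reserved Notation "f ⊗ g" (at level 39, left associativity).
Reserved Notation "σ ⊗₂ τ" (at level 39, left associativity).
Reserved Notation "σ • τ" (at level 45, left associativity).
Reserved Notation "σ ≡ τ" (at level 70, no associativity).
Reserved Notation "σ ≡e τ" (at level 70, no associativity).
Reserved Notation "σ •e τ" (at level 45, left associativity).
Reserved Notation "σ ∘e τ" (at level 40, left associativity).
Reserved Notation "σ ⊗e τ" (at level 39, left associativity).

Definition wid m (i : 'I_m) : 'I_m.+1 := widen_ord (leqnSn m) i.

Fixpoint foldN (A : Type) (op : A -> A -> A) m : ('I_m.+1 -> A) -> A :=
  match m return ('I_m.+1 -> A) -> A with
  | 0 => fun f => f ord0
  | m'.+1 => fun f => op (f ord0) (foldN op (fun j => f (lift ord0 j)))
  end.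

Definition chain (A : Type) (R : A -> A -> Prop) m (f : 'I_m.+1 -> A) : Prop :=
  forall i : 'I_m, R (f (wid i)) (f (lift ord0 i)).

(* f_0, ..., op f_i f_(i+1), ..., f_(m+1) *)
Definition merge (A : Type) (op : A -> A -> A) m (i : 'I_m.+1)
    (f : 'I_m.+2 -> A) (j : 'I_m.+1) : A :=
  if (j < i)%N then f (wid j)
  else if (j == i :> nat) then op (f (wid j)) (f (lift ord0 j))
  else f (lift ord0 j).

Definition two (A : Type) (a b : A) (j : 'I_2) : A :=
  if nat_of_ord j is 0%N then a else b.

Section FoldTheory.
Variables (A : Type) (op : A -> A -> A) (R : A -> A -> Prop).
Hypothesis opA : forall a b c, R a b -> R b c -> op a (op b c) = op (op a b) c.
Hypothesis R_opl : forall a b c, R a b -> R b c -> R (op a b) c.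
Hypothesis R_opr : forall a b c, R a b -> R b c -> R a (op b c).

Lemma eq_foldN m (f g : 'I_m.+1 -> A) : f =1 g -> foldN op f = foldN op g.
Proof.
elim: m f g => [|m IH] f g e /=; first exact: e.
by rewrite e; congr op; apply: IH => j; apply: e.
Qed.

Lemma foldNS m (f : 'I_m.+2 -> A) :
  foldN op f = op (f ord0) (foldN op (fun j => f (lift ord0 j))).
Proof. by []. Qed.

Lemma chain_behead m (f : 'I_m.+2 -> A) :
  chain R f -> chain R (fun j => f (lift ord0 j)).
Proof.
move=> Cf i; have := Cf (lift ord0 i); congr (R (f _) _); exact: val_inj.
Qed.

Lemma chain_head m (f : 'I_m.+2 -> A) :
  chain R f -> R (f ord0) (f (lift ord0 ord0)).
Proof. by move=> /(_ ord0); congr (R (f _) _); exact: val_inj. Qed.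

Lemma chain_belast m (f : 'I_m.+2 -> A) : chain R f -> chain R (fun j => f (wid j)).
Proof.
move=> Cf i; have := Cf (wid i); congr (R _ (f _)); exact: val_inj.
Qed.

Lemma chain_fold m (f : 'I_m.+2 -> A) :
  chain R f -> R (f ord0) (foldN op (fun j => f (lift ord0 j))).
Proof.
elim: m f => [|m IH] f Cf /=; first exact: chain_head.
by apply: R_opr; [exact: chain_head | exact: IH (chain_behead Cf)].
Qed.

Lemma foldN_merge m (i : 'I_m.+1) (f : 'I_m.+2 -> A) :
  chain R f -> foldN op (merge op i f) = foldN op f.
Proof.
elim: m i f => [|m IH] i f Cf.
  by rewrite (ord1 i) /= /merge /=; congr op; congr f; exact: val_inj.
case: (unliftP ord0 i) => [i'|] ->.
  rewrite [RHS]foldNS -(IH i' _ (chain_behead Cf)) /=; congr op.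
    by rewrite /merge /=; congr f; exact: val_inj.
  apply: eq_foldN => j; rewrite /merge /= /bump /= !add1n ltnS eqSS.
  have -> : wid (lift ord0 j) = lift ord0 (wid j) :> 'I_m.+3 by exact: val_inj.
  by [].
have Cf' := chain_behead Cf.
rewrite [RHS]foldNS foldNS opA; first last.
- exact: chain_fold Cf'.
- exact: chain_head.
rewrite /=; congr op.
by rewrite /merge /=; congr op; congr f; exact: val_inj.
Qed.

Lemma wid_lift m (j : 'I_m.+1) : wid (lift ord0 j) = lift ord0 (wid j).
Proof. exact: val_inj. Qed.

Lemma wid0 m : wid (ord0 : 'I_m.+1) = ord0.
Proof. exact: val_inj. Qed.

Lemma lift0_max m : lift ord0 (ord_max : 'I_m.+1) = ord_max.
Proof. exact: val_inj. Qed.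

Lemma foldN_belast m (f : 'I_m.+3 -> A) :
  foldN op (fun j => f (wid j)) =
  op (f ord0) (foldN op (fun j => f (lift ord0 (wid j)))).
Proof. by rewrite /= wid0; congr op; apply: eq_foldN => j; rewrite wid_lift. Qed.

Lemma chain_fold_last m (f : 'I_m.+2 -> A) :
  chain R f -> R (foldN op (fun j => f (wid j))) (f ord_max).
Proof.
elim: m f => [|m IH] f Cf.
  have := chain_head Cf; rewrite /= wid0; congr (R _ (f _)); exact: val_inj.
have H := IH _ (chain_behead Cf); rewrite lift0_max in H.
rewrite foldN_belast; apply: R_opl H.
have := chain_fold (chain_belast Cf); rewrite wid0.
by congr (R _ _); apply: eq_foldN => j; rewrite wid_lift.
Qed.

Lemma foldN_last m (f : 'I_m.+2 -> A) : chain R f ->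
  op (foldN op (fun j => f (wid j))) (f ord_max) = foldN op f.
Proof.
elim: m f => [|m IH] f Cf.
  by rewrite /= wid0; congr op; congr f; exact: val_inj.
have Cf' := chain_behead Cf.
rewrite foldN_belast [RHS]foldNS -(IH _ Cf') lift0_max opA //.
- have := chain_fold (chain_belast Cf); rewrite wid0.
  by congr (R _ _); apply: eq_foldN => j; rewrite wid_lift.
- by have := chain_fold_last Cf'; rewrite lift0_max.
Qed.

End FoldTheory.

(* All 1-morphisms form a single type with source [dom] and target [cod], so *)
(* that strict associativity of composition and of the tensor product are    *)
(* equalities in that type.  [comp g f] is meaningful only when              *)
(* [dom g = cod f] and [hom2 f g] only when [f] and [g] are parallel: the    *)
(* laws constrain composites of composable pairs only, and [hom2 f g] is the *)
(* zero module for non-parallel [f] and [g].                                 *)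
Record twocat_data (K : comPzRingType) := TwocatData {
  ob : Type;
  mor : Type;
  dom : mor -> ob;
  cod : mor -> ob;
  idm : ob -> mor;
  comp : mor -> mor -> mor;
  hom2 : mor -> mor -> lmodType K;
  id2 : forall f, hom2 f f;
  vcomp : forall f g h, hom2 g h -> hom2 f g -> hom2 f h;
  hcomp : forall g g' f f',
    hom2 g g' -> hom2 f f' -> hom2 (comp g f) (comp g' f')
}.

Arguments dom {K t}.
Arguments cod {K t}.
Arguments idm {K t}.
Arguments comp {K t}.
Arguments hom2 {K t}.
Arguments id2 {K t}.
Arguments vcomp {K t f g h}.
Arguments hcomp {K t g g' f f'}.

Notation "g ∘ f" := (comp g f).
Notation "σ • τ" := (vcomp σ τ).
Notation "σ ∘₂ τ" := (hcomp σ τ).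

Section TwoCatPredicates.
Variables (K : comPzRingType) (C : twocat_data K).
Implicit Types f g h : mor C.

Definition composable g f : Prop := dom g = cod f.

Definition parallel f g : Prop := dom f = dom g /\ cod f = cod g.

Definition cast2 f f' g g' (ef : f = f') (eg : g = g') (σ : hom2 f g) :
    hom2 f' g' :=
  match ef in _ = f1, eg in _ = g1 return hom2 f1 g1 with
  | erefl, erefl => σ
  end.

(* equality of 2-morphisms whose boundaries are equal, but not necessarily   *)
(* convertible, 1-morphisms                                                  *)
Definition eq2 f f' g g' (σ : hom2 f g) (τ : hom2 f' g') : Prop :=
  exists (ef : f = f') (eg : g = g'), cast2 ef eg σ = τ.

Definition idto f g (e : f = g) : hom2 f g := cast2 erefl e (id2 f).

Definition invertible2 f g (σ : hom2 f g) : Prop :=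
  exists τ : hom2 g f, τ • σ = id2 f /\ σ • τ = id2 g.

End TwoCatPredicates.

Notation "σ ≡ τ" := (eq2 σ τ).

Record twocat_laws (K : comPzRingType) (C : twocat_data K) : Prop := TwocatLaws {
  dom_id : forall X : ob C, dom (idm X) = X;
  cod_id : forall X : ob C, cod (idm X) = X;
  dom_comp : forall g f : mor C, composable g f -> dom (g ∘ f) = dom f;
  cod_comp : forall g f : mor C, composable g f -> cod (g ∘ f) = cod g;
  compA : forall h g f : mor C,
    composable h g -> composable g f -> h ∘ (g ∘ f) = (h ∘ g) ∘ f;
  comp1m : forall f : mor C, idm (cod f) ∘ f = f;
  compm1 : forall f : mor C, f ∘ idm (dom f) = f;

  hom2_parallel : forall (f g : mor C) (σ : hom2 f g), ~ parallel f g -> σ = 0;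
  vcompA : forall (e f g h : mor C)
    (ρ : hom2 g h) (σ : hom2 f g) (τ : hom2 e f), ρ • (σ • τ) = (ρ • σ) • τ;
  vcomp1l : forall (f g : mor C) (σ : hom2 f g), id2 g • σ = σ;
  vcomp1r : forall (f g : mor C) (σ : hom2 f g), σ • id2 f = σ;
  vcomp_linearl : forall (f g h : mor C) (τ : hom2 f g),
    linear (fun σ : hom2 g h => σ • τ);
  vcomp_linearr : forall (f g h : mor C) (σ : hom2 g h),
    linear (fun τ : hom2 f g => σ • τ);

  hcomp_id : forall g f : mor C,
    composable g f -> id2 g ∘₂ id2 f = id2 (g ∘ f);
  hcomp_vcomp : forall (g g' g'' f f' f'' : mor C)
    (σ' : hom2 g' g'') (σ : hom2 g g') (τ' : hom2 f' f'') (τ : hom2 f f'),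
    composable g f -> (σ' • σ) ∘₂ (τ' • τ) = (σ' ∘₂ τ') • (σ ∘₂ τ);
  hcompA : forall (h h' g g' f f' : mor C)
    (ρ : hom2 h h') (σ : hom2 g g') (τ : hom2 f f'),
    parallel h h' -> parallel g g' -> parallel f f' ->
    composable h g -> composable g f -> ρ ∘₂ (σ ∘₂ τ) ≡ (ρ ∘₂ σ) ∘₂ τ;
  hcomp1l : forall (f f' : mor C) (σ : hom2 f f'),
    parallel f f' -> id2 (idm (cod f)) ∘₂ σ ≡ σ;
  hcomp1r : forall (f f' : mor C) (σ : hom2 f f'),
    parallel f f' -> σ ∘₂ id2 (idm (dom f)) ≡ σ;
  hcomp_linearl : forall (g g' f f' : mor C) (τ : hom2 f f'),
    composable g f -> linear (fun σ : hom2 g g' => σ ∘₂ τ);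
  hcomp_linearr : forall (g g' f f' : mor C) (σ : hom2 g g'),
    composable g f -> linear (fun τ : hom2 f f' => σ ∘₂ τ)
}.

Record twocat (K : comPzRingType) := Twocat {
  twocat_data_of :> twocat_data K;
  twocatP : twocat_laws twocat_data_of
}.

(* [tnr f' g' f g] is the 2-morphism written with the pairs (f',g'), (f,g);  *)
(* it is meaningful only when f', f and g', g are composable.                *)
Record gray_data (K : comPzRingType) (C : twocat K) := GrayData {
  teno : ob C -> ob C -> ob C;
  ten : mor C -> mor C -> mor C;
  ten2 : forall f f' g g' : mor C,
    hom2 f f' -> hom2 g g' -> hom2 (ten f g) (ten f' g');
  tnr : forall f' g' f g : mor C,
    hom2 (ten f' g' ∘ ten f g) (ten (f' ∘ f) (g' ∘ g))
}.

Arguments teno {K C} G : rename.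
Arguments ten {K C} G : rename.
Arguments ten2 {K C} G {f f' g g'} : rename.
Arguments tnr {K C} G : rename.

Section GrayLaws.
Variables (K : comPzRingType) (C : twocat K) (G : gray_data C).
Local Notation "f ⊗ g" := (ten G f g).
Local Notation "σ ⊗₂ τ" := (ten2 G σ τ).
Local Notation tnr := (tnr G).
Implicit Types f g h : mor C.

Record gray_laws : Prop := GrayLaws {
  dom_ten : forall f g, dom (f ⊗ g) = teno G (dom f) (dom g);
  cod_ten : forall f g, cod (f ⊗ g) = teno G (cod f) (cod g);

  ten2_id : forall f g, id2 f ⊗₂ id2 g = id2 (f ⊗ g);
  ten2_vcomp : forall f f' f'' g g' g''
    (τ' : hom2 f' f'') (τ : hom2 f f') (σ' : hom2 g' g'') (σ : hom2 g g'),
    (τ' • τ) ⊗₂ (σ' • σ) = (τ' ⊗₂ σ') • (τ ⊗₂ σ);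
  ten2_linearl : forall f f' g g' (σ : hom2 g g'),
    linear (fun τ : hom2 f f' => τ ⊗₂ σ);
  ten2_linearr : forall f f' g g' (τ : hom2 f f'),
    linear (fun σ : hom2 g g' => τ ⊗₂ σ);

  tenoA : forall X Y Z, teno G X (teno G Y Z) = teno G (teno G X Y) Z;
  tenA : forall f g h, f ⊗ (g ⊗ h) = (f ⊗ g) ⊗ h;
  ten2A : forall f f' g g' h h' (ρ : hom2 f f') (σ : hom2 g g') (τ : hom2 h h'),
    ρ ⊗₂ (σ ⊗₂ τ) ≡ (ρ ⊗₂ σ) ⊗₂ τ;

  ten_idm : forall X Y : ob C, idm X ⊗ idm Y = idm (teno G X Y);

  tnr_iso : forall f' g' f g, composable f' f -> composable g' g ->
    invertible2 (tnr f' g' f g);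
  tnr_nat : forall f' g' f g f1' g1' f1 g1
    (τ' : hom2 f' f1') (σ' : hom2 g' g1') (τ : hom2 f f1) (σ : hom2 g g1),
    composable f' f -> composable g' g ->
    composable f1' f1 -> composable g1' g1 ->
    tnr f1' g1' f1 g1 • ((τ' ⊗₂ σ') ∘₂ (τ ⊗₂ σ)) =
    ((τ' ∘₂ τ) ⊗₂ (σ' ∘₂ σ)) • tnr f' g' f g;
  tnr_cocycle : forall f'' g'' f' g' f g,
    composable f'' f' -> composable g'' g' ->
    composable f' f -> composable g' g ->
    tnr f'' g'' (f' ∘ f) (g' ∘ g) • (id2 (f'' ⊗ g'') ∘₂ tnr f' g' f g)
    ≡ tnr (f'' ∘ f') (g'' ∘ g') f g • (tnr f'' g'' f' g' ∘₂ id2 (f ⊗ g));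
  tnr_idl : forall f g,
    tnr (idm (cod f)) (idm (cod g)) f g ≡ id2 (f ⊗ g);
  tnr_idr : forall f g,
    tnr f g (idm (dom f)) (idm (dom g)) ≡ id2 (f ⊗ g);
  tnr_cubicall : forall f' f g, composable f' f ->
    tnr f' (idm (cod g)) f g ≡ id2 ((f' ∘ f) ⊗ g);
  tnr_cubicalr : forall f g' g, composable g' g ->
    tnr f g' (idm (dom f)) g ≡ id2 (f ⊗ (g' ∘ g));
  tnr_ten : forall f' g' h' f g h,
    composable f' f -> composable g' g -> composable h' h ->
    (tnr f' g' f g ⊗₂ id2 (h' ∘ h)) • tnr (f' ⊗ g') h' (f ⊗ g) h
    ≡ (id2 (f' ∘ f) ⊗₂ tnr g' h' g h) • tnr f' (g' ⊗ h') f (g ⊗ h)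
}.

End GrayLaws.

Record gray_semigroup (K : comPzRingType) := GraySemigroup {
  gray_cat :> twocat K;
  gray_str : gray_data gray_cat;
  grayP : gray_laws gray_str
}.

Arguments gray_str {K} g.

Notation "f ⊗ g" := (ten (gray_str _) f g).
Notation "σ ⊗₂ τ" := (ten2 (gray_str _) σ τ).

Section Deformations.
Variables (K : comPzRingType) (C : gray_semigroup K).
Implicit Types f g h k : mor C.
Local Notation tnr := (tnr (gray_str C)).

(* (σ.1, σ.2) is the 2-morphism σ.1 + σ.2 ε of C_ε *)
Definition hom2e f g : Type := (hom2 f g * hom2 f g)%type.

Definition id2e f : hom2e f f := (id2 f, 0).

Definition vcompe f g h (σ : hom2e g h) (τ : hom2e f g) : hom2e f h :=
  (σ.1 • τ.1, σ.1 • τ.2 + σ.2 • τ.1).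

Definition hcompe g g' f f' (σ : hom2e g g') (τ : hom2e f f') :
    hom2e (g ∘ f) (g' ∘ f') :=
  (σ.1 ∘₂ τ.1, σ.1 ∘₂ τ.2 + σ.2 ∘₂ τ.1).

Definition ten2e f f' g g' (σ : hom2e f f') (τ : hom2e g g') :
    hom2e (f ⊗ g) (f' ⊗ g') :=
  (σ.1 ⊗₂ τ.1, σ.1 ⊗₂ τ.2 + σ.2 ⊗₂ τ.1).

Local Notation "σ •e τ" := (vcompe σ τ).
Local Notation "σ ∘e τ" := (hcompe σ τ).
Local Notation "σ ⊗e τ" := (ten2e σ τ).

Definition eq2e f f' g g' (σ : hom2e f g) (τ : hom2e f' g') : Prop :=
  σ.1 ≡ τ.1 /\ σ.2 ≡ τ.2.
Local Notation "σ ≡e τ" := (eq2e σ τ).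

Definition invertible2e f g (σ : hom2e f g) : Prop :=
  exists τ : hom2e g f, τ •e σ = id2e f /\ σ •e τ = id2e g.

(* first order parts of the two families; the normalization of [tnr1] where  *)
(* it has no meaning makes this the type of pairs of families indexed by     *)
(* composable pairs and by triples of 1-morphisms                            *)
Record deformation_data := DeformationData {
  tnr1 : forall f' g' f g, hom2 ((f' ⊗ g') ∘ (f ⊗ g)) ((f' ∘ f) ⊗ (g' ∘ g));
  asc1 : forall f g h, hom2 ((f ⊗ g) ⊗ h) (f ⊗ (g ⊗ h));
  tnr1_default : forall f' g' f g,
    ~ (composable f' f /\ composable g' g) -> tnr1 f' g' f g = 0
}.

Section Families.
Variable D : deformation_data.

Definition tnre f' g' f g :
    hom2e ((f' ⊗ g') ∘ (f ⊗ g)) ((f' ∘ f) ⊗ (g' ∘ g)) :=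
  (tnr f' g' f g, tnr1 D f' g' f g).

Definition asce f g h : hom2e ((f ⊗ g) ⊗ h) (f ⊗ (g ⊗ h)) :=
  (idto (esym (tenA (grayP C) f g h)), asc1 D f g h).

Record deformation_laws : Prop := DeformationLaws {
  tnre_iso : forall f' g' f g, composable f' f -> composable g' g ->
    invertible2e (tnre f' g' f g);
  tnre_nat : forall f' g' f g f1' g1' f1 g1
    (τ' : hom2e f' f1') (σ' : hom2e g' g1') (τ : hom2e f f1) (σ : hom2e g g1),
    composable f' f -> composable g' g ->
    composable f1' f1 -> composable g1' g1 ->
    tnre f1' g1' f1 g1 •e ((τ' ⊗e σ') ∘e (τ ⊗e σ)) =
    ((τ' ∘e τ) ⊗e (σ' ∘e σ)) •e tnre f' g' f g;
  tnre_cocycle : forall f'' g'' f' g' f g,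
    composable f'' f' -> composable g'' g' ->
    composable f' f -> composable g' g ->
    tnre f'' g'' (f' ∘ f) (g' ∘ g) •e (id2e (f'' ⊗ g'') ∘e tnre f' g' f g)
    ≡e tnre (f'' ∘ f') (g'' ∘ g') f g •e (tnre f'' g'' f' g' ∘e id2e (f ⊗ g));
  tnre_idl : forall f g,
    tnre (idm (cod f)) (idm (cod g)) f g ≡e id2e (f ⊗ g);
  tnre_idr : forall f g,
    tnre f g (idm (dom f)) (idm (dom g)) ≡e id2e (f ⊗ g);

  asce_iso : forall f g h, invertible2e (asce f g h);
  asce_nat : forall f g h f1 g1 h1
    (ρ : hom2e f f1) (σ : hom2e g g1) (τ : hom2e h h1),
    asce f1 g1 h1 •e ((ρ ⊗e σ) ⊗e τ) = (ρ ⊗e (σ ⊗e τ)) •e asce f g h;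
  asce_id : forall X Y Z : ob C,
    asce (idm X) (idm Y) (idm Z) ≡e id2e (idm X ⊗ (idm Y ⊗ idm Z));
  asce_tnre : forall f' g' h' f g h,
    composable f' f -> composable g' g -> composable h' h ->
    asce (f' ∘ f) (g' ∘ g) (h' ∘ h)
      •e (tnre f' g' f g ⊗e id2e (h' ∘ h))
      •e tnre (f' ⊗ g') h' (f ⊗ g) h
    = (id2e (f' ∘ f) ⊗e tnre g' h' g h)
      •e tnre f' (g' ⊗ h') f (g ⊗ h)
      •e (asce f' g' h' ∘e id2e (f ⊗ (g ⊗ h)))
      •e (id2e ((f' ⊗ g') ⊗ h') ∘e asce f g h);
  asce_pentagon : forall f g h k,
    asce f g (h ⊗ k) •e asce (f ⊗ g) h k
    = (id2e f ⊗e asce g h k) •e asce f (g ⊗ h) k •e (asce f g h ⊗e id2e k)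
}.

End Families.

Record deformation := Deformation {
  deformation_data_of :> deformation_data;
  deformationP : deformation_laws deformation_data_of
}.

Definition psi_equivalent (D D' : deformation) : Prop :=
  exists psi1 : forall f g, hom2 (f ⊗ g) (f ⊗ g),
  let psi f g : hom2e (f ⊗ g) (f ⊗ g) := (id2 (f ⊗ g), psi1 f g) in
  [/\ (forall f g, invertible2e (psi f g)),
      (forall f g f1 g1 (τ : hom2e f f1) (σ : hom2e g g1),
         psi f1 g1 •e (τ ⊗e σ) = (τ ⊗e σ) •e psi f g),
      (forall X Y : ob C, psi (idm X) (idm Y) = id2e (idm X ⊗ idm Y)),
      (forall f' g' f g, composable f' f -> composable g' g ->
         psi (f' ∘ f) (g' ∘ g) •e tnre D f' g' f g
         = tnre D' f' g' f g
           •e (psi f' g' ∘e id2e (f ⊗ g)) •e (id2e (f' ⊗ g') ∘e psi f g))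
    & (forall f g h,
         (id2e f ⊗e psi g h) •e psi f (g ⊗ h) •e asce D f g h
         = asce D' f g h •e (psi f g ⊗e id2e h) •e psi (f ⊗ g) h)].

(* the type of psi-equivalence classes, a class being the predicate          *)
(* [psi_equivalent D] of any of its members                                  *)
Definition psi_class : Type :=
  {A : deformation -> Prop | exists D, A = psi_equivalent D}.

End Deformations.

Section DoubleComplex.
Variables (K : comPzRingType) (C : gray_semigroup K).
Local Notation mor := (mor C).
Local Notation tnr := (tnr (gray_str C)).

Local Notation compN := (foldN (@comp K C)).
Local Notation tenN := (foldN (ten (gray_str C))).

Fixpoint hcompN m : forall s t : 'I_m.+1 -> mor,
    (forall j, hom2 (s j) (t j)) -> hom2 (compN s) (compN t) :=
  match m return forall s t : 'I_m.+1 -> mor,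
    (forall j, hom2 (s j) (t j)) -> hom2 (compN s) (compN t) with
  | 0 => fun s t σ => σ ord0
  | m'.+1 => fun s t σ => σ ord0 ∘₂ hcompN (fun j => σ (lift ord0 j))
  end.

Fixpoint ten2N n : forall s t : 'I_n.+1 -> mor,
    (forall k, hom2 (s k) (t k)) -> hom2 (tenN s) (tenN t) :=
  match n return forall s t : 'I_n.+1 -> mor,
    (forall k, hom2 (s k) (t k)) -> hom2 (tenN s) (tenN t) with
  | 0 => fun s t σ => σ ord0
  | n'.+1 => fun s t σ => σ ord0 ⊗₂ ten2N (fun k => σ (lift ord0 k))
  end.

(* [ent F j k] is f_j^(k+1), for a sequence f_0, ..., f_m of composable      *)
(* (n+1)-tuples of 1-morphisms, f_m being applied first                      *)
Record grid m n := Grid {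
  ent :> 'I_m.+1 -> 'I_n.+1 -> mor;
  gridP : forall k, chain (@composable K C) (fun j => ent j k)
}.

(* T_j and c^k *)
Definition gT m n (F : 'I_m.+1 -> 'I_n.+1 -> mor) (j : 'I_m.+1) : mor :=
  tenN (fun k => F j k).
Definition gc m n (F : 'I_m.+1 -> 'I_n.+1 -> mor) (k : 'I_n.+1) : mor :=
  compN (fun j => F j k).

Definition family m n : Type :=
  forall F : grid m n, hom2 (compN (gT F)) (tenN (gc F)).

Definition natural m n (φ : family m n) : Prop :=
  forall (F F' : grid m n) (σ : forall j k, hom2 (F j k) (F' j k)),
    φ F' • hcompN (fun j => ten2N (fun k => σ j k))
    = ten2N (fun k => hcompN (fun j => σ j k)) • φ F.

Definition special m n (φ : family m n) : Prop :=
  forall (F : grid m n) (j : 'I_m.+1),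
    (forall k, exists X, F j k = idm X) -> φ F = 0.

Fixpoint Theta2 m : forall f g : 'I_m.+1 -> mor,
    hom2 (compN (fun j => f j ⊗ g j)) (compN f ⊗ compN g) :=
  match m return forall f g : 'I_m.+1 -> mor,
    hom2 (compN (fun j => f j ⊗ g j)) (compN f ⊗ compN g) with
  | 0 => fun f g => id2 (f ord0 ⊗ g ord0)
  | m'.+1 => fun f g =>
      tnr (f ord0) (g ord0)
          (compN (fun j => f (lift ord0 j))) (compN (fun j => g (lift ord0 j)))
      • (id2 (f ord0 ⊗ g ord0)
         ∘₂ Theta2 (fun j => f (lift ord0 j)) (fun j => g (lift ord0 j)))
  end.

(* on sequences of pairs (n = 1 here) the recursive clause gives             *)
(* (1 ⊗ 1) • Theta2 = Theta2                                                 *)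
Fixpoint Theta m n : forall F : 'I_m.+1 -> 'I_n.+1 -> mor,
    hom2 (compN (gT F)) (tenN (gc F)) :=
  match n return forall F : 'I_m.+1 -> 'I_n.+1 -> mor,
    hom2 (compN (gT F)) (tenN (gc F)) with
  | 0 => fun F => id2 (compN (fun j => F j ord0))
  | n'.+1 => fun F =>
      (id2 (gc F ord0) ⊗₂ Theta (fun j k => F j (lift ord0 k)))
      • Theta2 (fun j => F j ord0) (gT (fun j k => F j (lift ord0 k)))
  end.

Lemma composable_compl (h g f : mor) :
  composable h g -> composable g f -> composable (h ∘ g) f.
Proof. by rewrite /composable => hg <-; rewrite (dom_comp (twocatP C)). Qed.

Lemma composable_compr (h g f : mor) :
  composable h g -> composable g f -> composable h (g ∘ f).
Proof. by rewrite /composable => -> gf; rewrite (cod_comp (twocatP C)). Qed.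

Lemma composable_ten (f' g' f g : mor) :
  composable f' f -> composable g' g -> composable (f' ⊗ g') (f ⊗ g).
Proof.
rewrite /composable => ff gg.
by rewrite (dom_ten (grayP C)) (cod_ten (grayP C)) ff gg.
Qed.

Lemma composable_tenN n (f' f : 'I_n.+1 -> mor) :
  (forall k, composable (f' k) (f k)) -> composable (tenN f') (tenN f).
Proof.
elim: n f' f => [|n IH] f' f H /=; first exact: H.
by apply: composable_ten => //; apply: IH.
Qed.

Lemma chain_gT m n (F : grid m n) : chain (@composable K C) (gT F).
Proof. by move=> j; apply: composable_tenN => k; apply: gridP. Qed.

Lemma compN_merge m (i : 'I_m.+1) (f : 'I_m.+2 -> mor) :
  chain (@composable K C) f -> compN (merge comp i f) = compN f.
Proof.
apply: foldN_merge; [exact: compA (twocatP C)|exact: composable_compr].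
Qed.

Lemma tenN_merge n (i : 'I_n.+1) (f : 'I_n.+2 -> mor) :
  tenN (merge (ten (gray_str C)) i f) = tenN f.
Proof.
apply: (@foldN_merge _ _ (fun _ _ => True)) => // *; exact: tenA (grayP C) _ _ _.
Qed.

Lemma compN_last m (f : 'I_m.+2 -> mor) : chain (@composable K C) f ->
  compN (fun j => f (wid j)) ∘ f ord_max = compN f.
Proof.
apply: foldN_last; [exact: compA (twocatP C)|exact: composable_compl|].
exact: composable_compr.
Qed.

Lemma tenN_last n (f : 'I_n.+2 -> mor) :
  tenN (fun k => f (wid k)) ⊗ f ord_max = tenN f.
Proof.
apply: (@foldN_last _ _ (fun _ _ => True)) => // *; exact: tenA (grayP C) _ _ _.
Qed.

Lemma chain_merge m (i : 'I_m.+1) (f : 'I_m.+2 -> mor) :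
  chain (@composable K C) f -> chain (@composable K C) (merge comp i f).
Proof.
move=> Cf j; have := Cf (wid j); have := Cf (lift ord0 j).
have -> : wid (lift ord0 j) = lift ord0 (wid j) by exact: val_inj.
rewrite /merge /= /bump !add1n => R2 R1.
have -> : wid (lift ord0 j) = lift ord0 (wid j) by exact: val_inj.
case: (ltngtP j i) => [ji|ij|ji].
- case: (ltngtP j.+1 i) => // [ij|_]; first by move: ij; rewrite ltnS leqNgt ji.
  exact: composable_compr.
- by rewrite ltnNge (leq_trans (ltnW ij) (leqnSn j)) gtn_eqF // ltnS ltnW.
- by rewrite ji ltnNge leqnSn gtn_eqF //; apply: composable_compl.
Qed.

Lemma composable_merge n (i : 'I_n.+1) (f' f : 'I_n.+2 -> mor) k :
  (forall k, composable (f' k) (f k)) ->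
  composable (merge (ten (gray_str C)) i f' k) (merge (ten (gray_str C)) i f k).
Proof.
by move=> H; rewrite /merge; do 2![case: ifP => // _]; apply: composable_ten.
Qed.

(* f_1, ..., f_(m+1) *)
Program Definition grid_behead m n (F : grid m.+1 n) : grid m n :=
  Grid (ent := fun j k => F (lift ord0 j) k) _.
Next Obligation. exact: (chain_behead (gridP F k)). Qed.

(* f_0, ..., f_m *)
Program Definition grid_belast m n (F : grid m.+1 n) : grid m n :=
  Grid (ent := fun j k => F (wid j) k) _.
Next Obligation. exact: (chain_belast (gridP F k)). Qed.

(* ..., f_i ∘ f_(i+1), ... *)
Program Definition grid_comp m n (i : 'I_m.+1) (F : grid m.+1 n) : grid m n :=
  Grid (ent := fun j k => merge comp i (fun j => F j k) j) _.
Next Obligation. by have := chain_merge i (gridP F k). Qed.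

Program Definition grid_cbehead m n (F : grid m n.+1) : grid m n :=
  Grid (ent := fun j k => F j (lift ord0 k)) _.
Next Obligation. exact: gridP. Qed.

Program Definition grid_cbelast m n (F : grid m n.+1) : grid m n :=
  Grid (ent := fun j k => F j (wid k)) _.
Next Obligation. exact: gridP. Qed.

(* ..., f_j^i ⊗ f_j^(i+1), ... in each row *)
Program Definition grid_ten m n (i : 'I_n.+1) (F : grid m n.+1) : grid m n :=
  Grid (ent := fun j k => merge (ten (gray_str C)) i (F j) k) _.
Next Obligation. by move=> j; apply: composable_merge => l; apply: gridP. Qed.

Lemma grid_comp_src m n (i : 'I_m.+1) (F : grid m.+1 n) :
  compN (merge comp i (gT F)) = compN (gT F).
Proof. exact: compN_merge (chain_gT F). Qed.

Lemma grid_comp_tgt m n (i : 'I_m.+1) (F : grid m.+1 n) :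
  tenN (gc (grid_comp i F)) = tenN (gc F).
Proof. by apply: eq_foldN => k; apply: compN_merge (gridP F k). Qed.

Lemma grid_belast_src m n (F : grid m.+1 n) :
  compN (gT (grid_belast F)) ∘ gT F ord_max = compN (gT F).
Proof. exact: compN_last (chain_gT F). Qed.

Lemma grid_belast_tgt m n (F : grid m.+1 n) :
  tenN (fun k => gc (grid_belast F) k ∘ F ord_max k) = tenN (gc F).
Proof. by apply: eq_foldN => k; apply: compN_last (gridP F k). Qed.

Lemma grid_ten_src m n (i : 'I_n.+1) (F : grid m n.+1) :
  compN (gT (grid_ten i F)) = compN (gT F).
Proof. by apply: eq_foldN => j; apply: tenN_merge. Qed.

Lemma grid_ten_tgt m n (i : 'I_n.+1) (F : grid m n.+1) :
  tenN (merge (ten (gray_str C)) i (gc F)) = tenN (gc F).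
Proof. exact: tenN_merge. Qed.

Lemma grid_cbelast_src m n (F : grid m n.+1) :
  compN (fun j => gT (grid_cbelast F) j ⊗ F j ord_max) = compN (gT F).
Proof. by apply: eq_foldN => j; apply: (tenN_last (F j)). Qed.

Lemma grid_cbelast_tgt m n (F : grid m n.+1) :
  tenN (gc (grid_cbelast F)) ⊗ gc F ord_max = tenN (gc F).
Proof. exact: (tenN_last (gc F)). Qed.

(* the j-th factor of 1 ∘ Theta(f_i, f_(i+1)) ∘ 1 *)
Definition whisk_comp m n (i : 'I_m.+1) (F : grid m.+1 n) (j : 'I_m.+1) :
    hom2 (merge comp i (gT F) j) (gT (grid_comp i F) j) :=
  let a := F (wid j) in
  let b := F (lift ord0 j) in
  match (j < i)%N as x, (j == i :> nat) as y return
    hom2 (if x then tenN a else if y then tenN a ∘ tenN b else tenN b)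
         (tenN (fun k => if x then a k else if y then a k ∘ b k else b k))
  with
  | true, _ => id2 (tenN a)
  | false, true => Theta (two a b)
  | false, false => id2 (tenN b)
  end.

(* the k-th factor of 1 ⊗ Theta2((f_j^i, f_j^(i+1))_j) ⊗ 1 *)
Definition whisk_ten m n (i : 'I_n.+1) (F : grid m n.+1) (k : 'I_n.+1) :
    hom2 (gc (grid_ten i F) k) (merge (ten (gray_str C)) i (gc F) k) :=
  let a := fun j => F j (wid k) in
  let b := fun j => F j (lift ord0 k) in
  match (k < i)%N as x, (k == i :> nat) as y return
    hom2 (compN (fun j => if x then a j else if y then a j ⊗ b j else b j))
         (if x then compN a else if y then compN a ⊗ compN b else compN b)
  with
  | true, _ => id2 (compN a)
  | false, true => Theta2 a b
  | false, false => id2 (compN b)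
  end.

Definition delta_h m n (φ : family m n) : family m.+1 n := fun F =>
  Theta (two (F ord0) (gc (grid_behead F)))
    • (id2 (gT F ord0) ∘₂ φ (grid_behead F))
  + \sum_(i < m.+1) (-1) ^+ i.+1 *:
      cast2 (grid_comp_src i F) (grid_comp_tgt i F)
        (φ (grid_comp i F) • hcompN (whisk_comp i F))
  + (-1) ^+ m.+2 *:
      cast2 (grid_belast_src F) (grid_belast_tgt F)
        (Theta (two (gc (grid_belast F)) (F ord_max))
         • (φ (grid_belast F) ∘₂ id2 (gT F ord_max))).

Definition delta_v m n (φ : family m n) : family m n.+1 := fun F =>
  (id2 (gc F ord0) ⊗₂ φ (grid_cbehead F))
    • Theta2 (fun j => F j ord0) (gT (grid_cbehead F))
  + \sum_(i < n.+1) (-1) ^+ i.+1 *: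
      cast2 (grid_ten_src i F) (grid_ten_tgt i F)
        (ten2N (whisk_ten i F) • φ (grid_ten i F))
  + (-1) ^+ n.+2 *:
      cast2 (grid_cbelast_src F) (grid_cbelast_tgt F)
        ((φ (grid_cbelast F) ⊗₂ id2 (gc F ord_max))
         • Theta2 (gT (grid_cbelast F)) (fun j => F j ord_max)).

End DoubleComplex.

Section TotalComplex.
Variables (K : comPzRingType) (C : gray_semigroup K).

(* all bigraded families; [tot q] below is the direct sum of the             *)
(* X_s^(m,n) with m + n = q and n >= 1, as a subgroup of this type           *)
Definition cochain : Type := forall m n, family C m n.

HB.instance Definition _ := gen_eqMixin cochain.
HB.instance Definition _ := gen_choiceMixin cochain.

Lemma cochainP (x y : cochain) : (forall m n F, x m n F = y m n F) -> x = y.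
Proof.
move=> e; apply: functional_extensionality_dep => m.
apply: functional_extensionality_dep => n.
by apply: functional_extensionality_dep => F.
Qed.

Definition cochain0 : cochain := fun m n F => 0.
Definition cochain_opp (x : cochain) : cochain := fun m n F => - x m n F.
Definition cochain_add (x y : cochain) : cochain :=
  fun m n F => x m n F + y m n F.

Fact cochain_addA : associative cochain_add.
Proof. by move=> x y z; apply: cochainP => m n F; apply: addrA. Qed.
Fact cochain_addC : commutative cochain_add.
Proof. by move=> x y; apply: cochainP => m n F; apply: addrC. Qed.
Fact cochain_add0 : left_id cochain0 cochain_add.
Proof. by move=> x; apply: cochainP => m n F; apply: add0r. Qed.
Fact cochain_addN : left_inverse cochain0 cochain_opp cochain_add.
Proof. by move=> x; apply: cochainP => m n F; apply: addNr. Qed.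

HB.instance Definition _ := GRing.isZmodule.Build cochain
  cochain_addA cochain_addC cochain_add0 cochain_addN.

Definition tot (q : nat) (x : cochain) : Prop :=
  forall m n, [/\ natural (x m n), special (x m n) &
    ~~ ((m + n == q) && (1 <= n))%N -> x m n = fun=> 0].

Definition delta_h_part (x : cochain) m n : family C m n :=
  match m return family C m n with
  | 0 => fun=> 0
  | m'.+1 => fun F => (-1) ^+ n *: delta_h (x m' n) F
  end.

Definition delta_v_part (x : cochain) m n : family C m n :=
  match n return family C m n with
  | 0 => fun=> 0
  | n'.+1 => fun F => delta_v (x m n') F
  end.

Definition delta (x : cochain) : cochain :=
  fun m n F => delta_h_part x F + delta_v_part x F.

Let linearB (U V : lmodType K) (f : U -> V) : linear f -> {morph f : x y / x - y}.
Proof. by move=> lf x y; rewrite addrC -scaleN1r lf scaleN1r addrC. Qed.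

Let vcompBl f g h (τ : hom2 f g) :
  {morph (fun σ : hom2 g h => σ • τ) : x y / x - y} :=
  linearB (vcomp_linearl (twocatP C) τ).
Let vcompBr f g h (σ : hom2 g h) :
  {morph (fun τ : hom2 f g => σ • τ) : x y / x - y} :=
  linearB (vcomp_linearr (twocatP C) σ).
Let ten2Bl f f' g g' (σ : hom2 g g') :
  {morph (fun τ : hom2 f f' => τ ⊗₂ σ) : x y / x - y} :=
  linearB (ten2_linearl (grayP C) σ).
Let ten2Br f f' g g' (τ : hom2 f f') :
  {morph (fun σ : hom2 g g' => τ ⊗₂ σ) : x y / x - y} :=
  linearB (ten2_linearr (grayP C) τ).
Let cast2B (f f' g g' : mor C) (ef : f = f') (eg : g = g') (x y : hom2 f g) :
  cast2 ef eg (x - y) = cast2 ef eg x - cast2 ef eg y.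
Proof. by case: _ / ef; case: _ / eg. Qed.

Let sum3B (V : zmodType) (a b c d e f : V) :
  a + c + e - (b + d + f) = a - b + (c - d) + (e - f).
Proof. by rewrite !opprD addrACA; congr (_ + _); rewrite addrACA. Qed.

Lemma delta_hB m n (φ ψ : family C m n) (F : grid C m.+1 n) :
  delta_h (fun F => φ F - ψ F) F = delta_h φ F - delta_h ψ F.
Proof.
rewrite /delta_h.
have c1 : composable (gT F ord0) (foldN comp (gT (grid_behead F))).
  exact: (chain_fold (@composable_compr _ _) (chain_gT F)).
have c2 : composable (foldN comp (gT (grid_belast F))) (gT F ord_max).
  exact: (chain_fold_last (@composable_compl _ _) (@composable_compr _ _)
    (chain_gT F)).
rewrite (linearB (hcomp_linearr (twocatP C) _ c1)) vcompBr.
rewrite (linearB (hcomp_linearl (twocatP C) _ c2)) vcompBr cast2B scalerBr.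
rewrite [RHS]sum3B; congr (_ + _ + _); rewrite -sumrB; apply: eq_bigr => i _.
by rewrite vcompBl cast2B scalerBr.
Qed.

Lemma delta_vB m n (φ ψ : family C m n) (F : grid C m n.+1) :
  delta_v (fun F => φ F - ψ F) F = delta_v φ F - delta_v ψ F.
Proof.
rewrite /delta_v ten2Br vcompBl ten2Bl vcompBl cast2B scalerBr [RHS]sum3B.
congr (_ + _ + _); rewrite -sumrB; apply: eq_bigr => i _.
by rewrite vcompBr cast2B scalerBr.
Qed.

Lemma deltaB : {morph delta : x y / x - y}.
Proof.
move=> x y; apply: cochainP => m n F.
rewrite -[RHS]/(delta x F - delta y F) /delta opprD addrACA; congr (_ + _).
  case: m F => [|m] F /=; first by rewrite subr0.
  by rewrite -scalerBr -delta_hB.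
by case: n F => [|n] F /=; [rewrite subr0 | rewrite -delta_vB].
Qed.

Lemma delta0 : delta 0 = 0.
Proof. by rewrite -[X in delta X](subrr 0) deltaB subrr. Qed.

Lemma tot0 q : tot q 0.
Proof.
move=> m n; split=> // F F' σ.
have E0 G : (0 : cochain) m n G = 0 by [].
have l0 (f g h : mor C) (τ : hom2 f g) : (0 : hom2 g h) • τ = 0.
  by have := vcompBl τ (0 : hom2 g h) 0; rewrite !subrr.
have r0 (f g h : mor C) (τ : hom2 g h) : τ • (0 : hom2 f g) = 0.
  by have := vcompBr τ (0 : hom2 f g) 0; rewrite !subrr.
by rewrite !E0 l0 r0.
Qed.

Lemma totB q x y : tot q x -> tot q y -> tot q (x - y).
Proof.
move=> tx ty m n; case: (tx m n) (ty m n) => [nx sx zx] [ny sy zy].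
have E F : (x - y) m n F = x m n F - y m n F by [].
split=> [F F' σ|F j id_j|out]; rewrite ?E.
- by rewrite vcompBl [RHS]vcompBr nx ny.
- by rewrite (sx F j) // (sy F j) // subrr.
- by apply: functional_extensionality_dep => F; rewrite E zx // zy // subrr.
Qed.

(* [delta] is defined on arbitrary families; cocycles and coboundaries are   *)
(* taken within [tot]                                                        *)
Definition is_cocycle (q : nat) : {pred cochain} :=
  fun x => `[< tot q x /\ delta x = 0 >].

Fact is_cocycle_zmod_closed q : zmod_closed (is_cocycle q).
Proof.
split; first by apply/asboolP; split; [exact: tot0 | exact: delta0].
move=> x y /asboolP[tx dx] /asboolP[ty dy]; apply/asboolP.
by split; [exact: totB | rewrite deltaB dx dy subrr].
Qed.

HB.instance Definition _ q :=
  GRing.isZmodClosed.Build cochain (is_cocycle q) (is_cocycle_zmod_closed q).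

Record cocycle (q : nat) := Cocycle {
  cocycle_val :> cochain;
  cocycleP : cocycle_val \in is_cocycle q
}.

HB.instance Definition _ q := [isSub for @cocycle_val q].
HB.instance Definition _ q := [Choice of cocycle q by <:].
HB.instance Definition _ q := [SubChoice_isSubZmodule of cocycle q by <:].

(* [tot q.-1] is the degree q - 1 part of the total complex for every q,     *)
(* since [tot 0] is zero                                                     *)
Definition is_coboundary (q : nat) : {pred cocycle q} :=
  fun z => `[< exists2 y, tot q.-1 y & delta y = z >].

Fact is_coboundary_zmod_closed q : zmod_closed (@is_coboundary q).
Proof.
split; first by apply/asboolP; exists 0; [exact: tot0 | exact: delta0].
move=> x y /asboolP[x' tx dx] /asboolP[y' ty dy]; apply/asboolP.
by exists (x' - y'); [exact: totB | rewrite deltaB dx dy].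
Qed.

HB.instance Definition _ q := GRing.isZmodClosed.Build (cocycle q)
  (@is_coboundary q) (is_coboundary_zmod_closed q).

End TotalComplex.

Definition H_tens_ass (K : comPzRingType) (C : gray_semigroup K) (q : nat) :
    zmodType :=
  Quotient.quot (@is_coboundary K C q).

(* Main.v *)
(* Over the dual numbers every deformation axiom splits into its value at     *)
(* epsilon = 0, which is a Gray semigroup axiom, and a linear equation in the *)
(* first order terms.  Written in the complex, where the associator term is   *)
(* transported along the strict associativity of the tensor product, these    *)
(* linear equations say exactly that (tensorator, associator) is a 2-cocycle: *)
(* naturality and unitality put it in the special cochains, and the cocycle   *)
(* identity, the associator-tensorator identity and the pentagon are the      *)
(* components of delta in X^(2,1), X^(1,2) and X^(0,3).  In the same way a    *)
(* psi-equivalence is a 1-cochain whose coboundary is the difference of the   *)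
(* two cocycles.                                                              *)

Require Import Defs.
From mathcomp Require Import all_boot all_algebra.
From mathcomp Require Import boolp.

Set Implicit Arguments.
Unset Strict Implicit.
Unset Printing Implicit Defensive.

Import GRing.Theory.
Local Open Scope ring_scope.

(** Since ε² = 0, expanding a deformation axiom by bilinearity leaves an order zero part, which
    holds in [C], and an order one part, a sum of terms in each of which exactly one factor is
    perturbed. Up to sign and the casts due to strict associativity, these terms are the summands of
    [delta_h] and [delta_v]. Hence [deformation_lawsP]: the laws hold iff [deformation_cochain] is a
    natural special cochain killed by [delta]. Invertibility is automatic
    ([invertible2e_first_order]).

    The degree 2 part of the complex is X^(1,1) plus X^(0,2), because n = 0 is excluded, so every
    2-cocycle comes from a deformation ([deformation_cocycle_surj]). The degree 1 part is X^(0,1),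
    whose elements are the first order terms of candidates for ψ, and the two compatibilities of ψ
    say that its coboundary is the difference of the two deformation cocycles ([psi_equivalentP]).
    So ψ-equivalence is equality of classes in the quotient ([psi_equivalent_pi]), and the classes
    biject with it.

    Associativity of 1-morphisms is an equality but not a conversion. Terms are therefore compared
    with [≡], which is plain equality between 2-morphisms of the same type ([eq2_eq]). *)

(** * Bilinearity of the compositions and of the tensor product *)

Lemma linear_fun0 (K : pzRingType) (U V : lmodType K) (f : U -> V) :
  linear f -> f 0 = 0.
Proof. by move=> /(_ (-1) 0 0); rewrite scaler0 addr0 scaleN1r addNr. Qed.

Lemma linear_funD (K : pzRingType) (U V : lmodType K) (f : U -> V) :
  linear f -> {morph f : x y / x + y}.
Proof. by move=> lf x y; rewrite -[x]scale1r lf !scale1r. Qed.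

Lemma linear_funN (K : pzRingType) (U V : lmodType K) (f : U -> V) :
  linear f -> {morph f : x / - x}.
Proof.
by move=> lf x; rewrite -scaleN1r -[_ *: x]addr0 lf (linear_fun0 lf) addr0 scaleN1r.
Qed.

Section Bilinearity.
Variables (K : comPzRingType) (C : gray_semigroup K).
Implicit Types f g h : mor C.

Lemma vcompDl f g h (σ σ' : hom2 g h) (τ : hom2 f g) :
  (σ + σ') • τ = σ • τ + σ' • τ.
Proof. exact: (linear_funD (vcomp_linearl (twocatP C) τ)). Qed.

Lemma vcompDr f g h (σ : hom2 g h) (τ τ' : hom2 f g) :
  σ • (τ + τ') = σ • τ + σ • τ'.
Proof. exact: (linear_funD (vcomp_linearr (twocatP C) σ)). Qed.

Lemma vcompNl f g h (σ : hom2 g h) (τ : hom2 f g) : (- σ) • τ = - (σ • τ).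
Proof. exact: (linear_funN (vcomp_linearl (twocatP C) τ)). Qed.

Lemma vcompNr f g h (σ : hom2 g h) (τ : hom2 f g) : σ • (- τ) = - (σ • τ).
Proof. exact: (linear_funN (vcomp_linearr (twocatP C) σ)). Qed.

Lemma hcomp0l g g' f f' (τ : hom2 f f') :
  composable g f -> (0 : hom2 g g') ∘₂ τ = 0.
Proof. by move=> c; apply: linear_fun0 (hcomp_linearl (twocatP C) τ c). Qed.

Lemma hcomp0r g g' f f' (σ : hom2 g g') :
  composable g f -> σ ∘₂ (0 : hom2 f f') = 0.
Proof. by move=> c; apply: linear_fun0 (hcomp_linearr (twocatP C) σ c). Qed.

Lemma hcompDl g g' f f' (σ σ' : hom2 g g') (τ : hom2 f f') :
  composable g f -> (σ + σ') ∘₂ τ = σ ∘₂ τ + σ' ∘₂ τ.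
Proof. by move=> c; apply: (linear_funD (hcomp_linearl (twocatP C) τ c)). Qed.

Lemma hcompDr g g' f f' (σ : hom2 g g') (τ τ' : hom2 f f') :
  composable g f -> σ ∘₂ (τ + τ') = σ ∘₂ τ + σ ∘₂ τ'.
Proof. by move=> c; apply: (linear_funD (hcomp_linearr (twocatP C) σ c)). Qed.

Lemma ten20l f f' g g' (τ : hom2 g g') : (0 : hom2 f f') ⊗₂ τ = 0.
Proof. exact: linear_fun0 (ten2_linearl (grayP C) τ). Qed.

Lemma ten20r f f' g g' (σ : hom2 f f') : σ ⊗₂ (0 : hom2 g g') = 0.
Proof. exact: linear_fun0 (ten2_linearr (grayP C) σ). Qed.

Lemma ten2Dl f f' g g' (σ σ' : hom2 f f') (τ : hom2 g g') :
  (σ + σ') ⊗₂ τ = σ ⊗₂ τ + σ' ⊗₂ τ.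
Proof. exact: (linear_funD (ten2_linearl (grayP C) τ)). Qed.

Lemma ten2Dr f f' g g' (σ : hom2 f f') (τ τ' : hom2 g g') :
  σ ⊗₂ (τ + τ') = σ ⊗₂ τ + σ ⊗₂ τ'.
Proof. exact: (linear_funD (ten2_linearr (grayP C) σ)). Qed.

End Bilinearity.

(** * Calculus of equality of 2-morphisms up to casts of the boundary *)

Section HeterogeneousEquality.
Variables (K : comPzRingType) (C : gray_semigroup K).
Implicit Types f g h : mor C.

Lemma eq2_refl f g (σ : hom2 f g) : σ ≡ σ.
Proof. by exists erefl, erefl. Qed.

Lemma eq2_sym f g f' g' (σ : hom2 f g) (τ : hom2 f' g') : σ ≡ τ -> τ ≡ σ.
Proof. by case=> ef [eg <-]; case: _ / ef; case: _ / eg; apply: eq2_refl. Qed.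

Lemma eq2_trans f g f' g' f'' g''
    (σ : hom2 f g) (τ : hom2 f' g') (ρ : hom2 f'' g'') :
  σ ≡ τ -> τ ≡ ρ -> σ ≡ ρ.
Proof. by case=> ef [eg <-]; case: _ / ef; case: _ / eg. Qed.

(** A cast along a loop is trivial by proof irrelevance. Goals can thus be moved to [≡], solved
    modulo casts, and moved back. *)
Lemma eq2_eq f g (σ τ : hom2 f g) : σ ≡ τ <-> σ = τ.
Proof.
split=> [[ef [eg <-]]|->]; last exact: eq2_refl.
by rewrite (Prop_irrelevance ef erefl) (Prop_irrelevance eg erefl).
Qed.

Lemma eq2_castl f g f' g' (ef : f = f') (eg : g = g') (σ : hom2 f g)
    f'' g'' (τ : hom2 f'' g'') :
  σ ≡ τ -> cast2 ef eg σ ≡ τ.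
Proof. by case: _ / ef; case: _ / eg. Qed.

Lemma eq2_cast f g f' g' (ef : f = f') (eg : g = g') (σ : hom2 f g) :
  cast2 ef eg σ ≡ σ.
Proof. exact/eq2_castl/eq2_refl. Qed.

Lemma eq2_idto f g (e : f = g) : idto e ≡ id2 f.
Proof. exact: eq2_cast. Qed.

Lemma eq2_id f g : f = g -> id2 f ≡ id2 g.
Proof. by move=> ->; apply: eq2_refl. Qed.

Lemma eq2_0l f g f' g' (σ : hom2 f g) : σ ≡ (0 : hom2 f' g') -> σ = 0.
Proof. by move=> /eq2_sym[ef [eg <-]]; case: _ / ef; case: _ / eg. Qed.

Lemma eq2_00 f g f' g' : f = f' -> g = g' -> (0 : hom2 f g) ≡ (0 : hom2 f' g').
Proof. by move=> -> ->; apply: eq2_refl. Qed.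

(** Transfers the vanishing of the first order defect of an axiom to the matching component of
    [delta], although the two lie in different hom-modules. *)
Lemma eq2_0 f g f' g' (σ : hom2 f g) (τ : hom2 f' g') :
  σ ≡ τ -> σ = 0 <-> τ = 0.
Proof. by case=> ef [eg <-]; case: _ / ef; case: _ / eg. Qed.

Lemma eq2_add f g f' g' (σ τ : hom2 f g) (σ' τ' : hom2 f' g') :
  σ ≡ σ' -> τ ≡ τ' -> σ + τ ≡ σ' + τ'.
Proof. by case=> ef [eg <-]; subst f' g' => /eq2_eq ->; apply: eq2_refl. Qed.

Lemma eq2_opp f g f' g' (σ : hom2 f g) (σ' : hom2 f' g') :
  σ ≡ σ' -> - σ ≡ - σ'.
Proof. by case=> ef [eg <-]; subst f' g'; apply: eq2_refl. Qed.

Lemma eq2_vcomp f g h f' g' h'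
    (σ : hom2 g h) (τ : hom2 f g) (σ' : hom2 g' h') (τ' : hom2 f' g') :
  σ ≡ σ' -> τ ≡ τ' -> σ • τ ≡ σ' • τ'.
Proof.
case=> eg [eh <-]; subst g' h'; case=> ef [eg <-]; subst f'.
by rewrite (Prop_irrelevance eg erefl); apply: eq2_refl.
Qed.

Lemma eq2_hcomp g1 g2 f1 f2 g1' g2' f1' f2' (σ : hom2 g1 g2) (τ : hom2 f1 f2)
    (σ' : hom2 g1' g2') (τ' : hom2 f1' f2') :
  σ ≡ σ' -> τ ≡ τ' -> σ ∘₂ τ ≡ σ' ∘₂ τ'.
Proof.
case=> e1 [e2 <-]; case=> e3 [e4 <-]; subst g1' g2' f1' f2'.
exact: eq2_refl.
Qed.

Lemma eq2_ten2 g1 g2 f1 f2 g1' g2' f1' f2' (σ : hom2 g1 g2) (τ : hom2 f1 f2)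
    (σ' : hom2 g1' g2') (τ' : hom2 f1' f2') :
  σ ≡ σ' -> τ ≡ τ' -> σ ⊗₂ τ ≡ σ' ⊗₂ τ'.
Proof.
case=> e1 [e2 <-]; case=> e3 [e4 <-]; subst g1' g2' f1' f2'.
exact: eq2_refl.
Qed.

(** The factor [σ] is an identity only up to a cast, as is the undeformed associator [idto]; this
    lemma and the next erase such factors. *)
Lemma eq2_vcomp_idl f g h k (σ : hom2 g h) (τ : hom2 f g) :
  σ ≡ id2 k -> σ • τ ≡ τ.
Proof.
case=> e1 [e2]; subst g h => /= ->.
by rewrite (vcomp1l (twocatP C)); apply: eq2_refl.
Qed.

Lemma eq2_vcomp_idr f g h k (σ : hom2 g h) (τ : hom2 f g) :
  τ ≡ id2 k -> σ • τ ≡ σ.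
Proof.
case=> e1 [e2]; subst f g => /= ->.
by rewrite (vcomp1r (twocatP C)); apply: eq2_refl.
Qed.

End HeterogeneousEquality.

(** * Small grids given by explicit entries *)

Section ConcreteGrids.
Variables (K : comPzRingType) (C : gray_semigroup K).
Implicit Types f g h l : mor C.

(* Grids with explicit rows are used because evaluating them at [wid ord0],    *)
(* [lift ord0 ord0], ... reduces, so that Theta, the whiskerings and merged   *)
(* grids compute; ordinals of equal value are not convertible, and neither    *)
(* are their images in an abstract grid.                                      *)
Definition three (A : Type) (a b c : A) m (j : 'I_m) : A :=
  match nat_of_ord j with 0 => a | 1 => b | _ => c end.

Definition four (A : Type) (a b c d : A) m (j : 'I_m) : A :=
  match nat_of_ord j with 0 => a | 1 => b | 2 => c | _ => d end.

Lemma grid_ext m n (F F' : grid C m n) : (forall j k, F j k = F' j k) -> F = F'.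
Proof.
case: F F' => [F cF] [F' cF'] /= E.
have EF : F = F' by do 2![apply: functional_extensionality_dep => ?]; apply: E.
by subst F'; rewrite (Prop_irrelevance cF cF').
Qed.

Lemma chain1 (A : Type) (R : A -> A -> Prop) (f : 'I_1 -> A) : chain R f.
Proof. by case. Qed.

Definition row2 f g : grid C 0 1 :=
  Grid (ent := fun _ => two f g) (fun k => chain1 _ _).

Definition row3 f g h : grid C 0 2 :=
  Grid (ent := fun _ => @three _ f g h 3) (fun k => chain1 _ _).

Definition row4 f g h l : grid C 0 3 :=
  Grid (ent := fun _ => @four _ f g h l 4) (fun k => chain1 _ _).

Lemma chain_two (R : mor C -> mor C -> Prop) n (u v : 'I_n -> mor C) :
  (forall k, R (u k) (v k)) ->
  forall k, chain R (fun j : 'I_2 => two u v j k).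
Proof. by move=> H k i; rewrite (ord1 i); apply: H. Qed.

Lemma chain_three (R : mor C -> mor C -> Prop) n (u v w : 'I_n -> mor C) :
  (forall k, R (u k) (v k)) -> (forall k, R (v k) (w k)) ->
  forall k, chain R (fun j : 'I_3 => three u v w j k).
Proof. by move=> H H' k [[|[|i]] lti]. Qed.

Lemma two_pair (R : mor C -> mor C -> Prop) f g f' g' :
  R f f' -> R g g' -> forall k : 'I_2, R (two f g k) (two f' g' k).
Proof. by move=> ? ? [[|[|k]] ltk]. Qed.

Lemma three_pair (R : mor C -> mor C -> Prop) f g h f' g' h' :
  R f f' -> R g g' -> R h h' ->
  forall k : 'I_3, R (three f g h k) (three f' g' h' k).
Proof. by move=> ? ? ? [[|[|[|k]]] ltk]. Qed.

Definition grid22 f' g' f g (cf : composable f' f) (cg : composable g' g) :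
    grid C 1 1 :=
  Grid (ent := two (two f' g') (two f g)) (chain_two (two_pair cf cg)).

Definition grid23 f' g' h' f g h (cf : composable f' f) (cg : composable g' g)
    (ch : composable h' h) : grid C 1 2 :=
  Grid (ent := two (@three _ f' g' h' 3) (@three _ f g h 3))
    (chain_two (three_pair cf cg ch)).

Definition grid32 f'' g'' f' g' f g
    (cf' : composable f'' f') (cg' : composable g'' g')
    (cf : composable f' f) (cg : composable g' g) : grid C 2 1 :=
  Grid (ent := @three _ (two f'' g'') (two f' g') (two f g) 3)
    (chain_three (two_pair cf' cg') (two_pair cf cg)).

(** By [grid_ext] a grid of this shape is determined by its entries. This principle and its
    analogues reduce statements about abstract grids to explicit ones, where everything computes. *)
Lemma row2_ind (P : grid C 0 1 -> Prop) :
  (forall f g, P (row2 f g)) -> forall F, P F.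
Proof.
move=> H F; have := H (F ord0 ord0) (F ord0 (inord 1)).
congr P; apply: grid_ext => -[[|i] lti] // [[|[|k]] ltk] //=; congr (F _ _);
  by apply: val_inj; rewrite //= inordK.
Qed.

Lemma row3_ind (P : grid C 0 2 -> Prop) :
  (forall f g h, P (row3 f g h)) -> forall F, P F.
Proof.
move=> H F; have := H (F ord0 ord0) (F ord0 (inord 1)) (F ord0 (inord 2)).
congr P; apply: grid_ext => -[[|i] lti] // [[|[|[|k]]] ltk] //=; congr (F _ _);
  by apply: val_inj; rewrite //= inordK.
Qed.

Lemma row4_ind (P : grid C 0 3 -> Prop) :
  (forall f g h l, P (row4 f g h l)) -> forall F, P F.
Proof.
move=> H F.
have := H (F ord0 ord0) (F ord0 (inord 1)) (F ord0 (inord 2)) (F ord0 (inord 3)).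
congr P; apply: grid_ext => -[[|i] lti] // [[|[|[|[|k]]]] ltk] //=; congr (F _ _);
  by apply: val_inj; rewrite //= inordK.
Qed.

(** Composability of consecutive rows in terms of ordinal values, so that it applies to [inord]
    indices, which are not of the form [wid] or [lift]. *)
Lemma grid_composable m n (F : grid C m n) (i : 'I_m.+1) (j : 'I_m.+1) k :
  j = i.+1 :> nat -> composable (F i k) (F j k).
Proof.
move=> E; have im : (i < m)%N by rewrite -ltnS -E.
have := gridP F k (Ordinal im).
by congr (composable (F _ _) (F _ _)); apply: val_inj; rewrite /= ?/bump.
Qed.

Lemma grid22_ind (P : grid C 1 1 -> Prop) :
  (forall f' g' f g cf cg, P (@grid22 f' g' f g cf cg)) -> forall F, P F.
Proof.
move=> H F; have c k : composable (F ord0 k) (F (inord 1) k).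
  by apply: grid_composable; rewrite inordK.
have := H _ _ _ _ (c ord0) (c (inord 1)).
congr P; apply: grid_ext => -[[|[|i]] lti] // [[|[|k]] ltk] //=; congr (F _ _);
  by apply: val_inj; rewrite //= inordK.
Qed.

Lemma grid23_ind (P : grid C 1 2 -> Prop) :
  (forall f' g' h' f g h cf cg ch, P (@grid23 f' g' h' f g h cf cg ch)) ->
  forall F, P F.
Proof.
move=> H F; have c k : composable (F ord0 k) (F (inord 1) k).
  by apply: grid_composable; rewrite inordK.
have := H _ _ _ _ _ _ (c ord0) (c (inord 1)) (c (inord 2)).
congr P; apply: grid_ext => -[[|[|i]] lti] // [[|[|[|k]]] ltk] //=; congr (F _ _);
  by apply: val_inj; rewrite //= inordK.
Qed.

Lemma grid32_ind (P : grid C 2 1 -> Prop) :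
  (forall f'' g'' f' g' f g cf' cg' cf cg,
     P (@grid32 f'' g'' f' g' f g cf' cg' cf cg)) -> forall F, P F.
Proof.
move=> H F; have c k : composable (F ord0 k) (F (inord 1) k).
  by apply: grid_composable; rewrite inordK.
have c' k : composable (F (inord 1) k) (F (inord 2) k).
  by apply: grid_composable; rewrite !inordK.
have := H _ _ _ _ _ _ (c ord0) (c (inord 1)) (c' ord0) (c' (inord 1)).
congr P; apply: grid_ext => -[[|[|[|i]]] lti] // [[|[|k]] ltk] //=; congr (F _ _);
  by apply: val_inj; rewrite //= inordK.
Qed.

End ConcreteGrids.

(** * Explicit formulas for the differentials in low bidegree *)

Section Differentials.
Variables (K : comPzRingType) (C : gray_semigroup K).
Implicit Types f g h l : mor C.
Local Notation tnr := (tnr (gray_str C)).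
Local Notation i1 := (lift ord0 ord0).
Local Notation i2 := (lift ord0 i1).

Lemma Theta2_two (u v : 'I_2 -> mor C) :
  composable (u ord0 ⊗ v ord0) (u i1 ⊗ v i1) ->
  Theta2 u v = tnr (u ord0) (v ord0) (u i1) (v i1).
Proof. by move=> c /=; rewrite (hcomp_id (twocatP C)) ?(vcomp1r (twocatP C)). Qed.

Lemma Theta_two (a b : 'I_2 -> mor C) :
  composable (a ord0 ⊗ a i1) (b ord0 ⊗ b i1) ->
  Theta (two a b) = tnr (a ord0) (a i1) (b ord0) (b i1).
Proof.
move=> c; rewrite /Theta Theta2_two //.
by rewrite (ten2_id (grayP C)) (vcomp1l (twocatP C)).
Qed.

Lemma Theta_three (a b : 'I_3 -> mor C) :
  (forall k, composable (a k) (b k)) ->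
  Theta (two a b) = (id2 (a ord0 ∘ b ord0) ⊗₂ tnr (a i1) (a i2) (b i1) (b i2))
    • tnr (a ord0) (a i1 ⊗ a i2) (b ord0) (b i1 ⊗ b i2).
Proof.
move=> c; rewrite /Theta Theta2_two; last by do ?apply: composable_ten; apply: c.
rewrite Theta2_two; last by do ?apply: composable_ten; apply: c.
by rewrite (ten2_id (grayP C)) (vcomp1l (twocatP C)).
Qed.

Definition psi_family (p : forall f g, hom2 (f ⊗ g) (f ⊗ g)) : Defs.family C 0 1 :=
  fun F => p (F ord0 ord0) (F ord0 i1).

(** The source is bracketed to the right because [tenN] folds that way, whereas [asc1] starts from
    the left bracketing; [asc1_family] will bridge the two. *)
Definition asc_family
    (a : forall f g h, hom2 (f ⊗ (g ⊗ h)) (f ⊗ (g ⊗ h))) : Defs.family C 0 2 :=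
  fun F => a (F ord0 ord0) (F ord0 i1) (F ord0 i2).

Definition tnr_family
    (t : forall f' g' f g, hom2 ((f' ⊗ g') ∘ (f ⊗ g)) ((f' ∘ f) ⊗ (g' ∘ g))) :
    Defs.family C 1 1 :=
  fun F => t (F ord0 ord0) (F ord0 i1) (F i1 ord0) (F i1 i1).

Lemma delta_h_psi p f' g' f g cf cg :
  delta_h (psi_family p) (@grid22 _ _ f' g' f g cf cg) =
    tnr f' g' f g • (id2 (f' ⊗ g') ∘₂ p f g)
    - p (f' ∘ f) (g' ∘ g) • tnr f' g' f g
    + tnr f' g' f g • (p f' g' ∘₂ id2 (f ⊗ g)).
Proof.
rewrite /delta_h big_ord_recl big_ord0 addr0 expr1 scaleN1r sqrrN expr1n scale1r.
have T := Theta_two (a := two f' g') (b := two f g) (composable_ten cf cg).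
apply/eq2_eq; apply: eq2_add; [apply: eq2_add|].
- by apply: eq2_vcomp; [apply/eq2_eq/T | apply: eq2_refl].
- apply/eq2_opp/eq2_castl/eq2_vcomp; [exact: eq2_refl | exact/eq2_eq/T].
- by apply/eq2_castl/eq2_vcomp; [apply/eq2_eq/T | apply: eq2_refl].
Qed.

(** Casts appear only on the terms built from left bracketed products. The equality proofs are
    existential because, by proof irrelevance, any proofs serve. *)
Lemma delta_v_psi p f g h : exists e1 e2,
  delta_v (psi_family p) (row3 f g h) =
    id2 f ⊗₂ p g h - cast2 e1 e1 (p (f ⊗ g) h) + p f (g ⊗ h)
    - cast2 e2 e2 (p f g ⊗₂ id2 h).
Proof.
have e := esym (tenA (grayP C) f g h).
exists e, e.
rewrite /delta_v !big_ord_recl big_ord0 addr0 !(exprS, expr0) !mulN1r !opprK.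
rewrite !scaleN1r !scale1r !addrA.
apply/eq2_eq; apply: eq2_add; [apply: eq2_add; [apply: eq2_add|]|].
- by rewrite (vcomp1r (twocatP C)); apply: eq2_refl.
(* The two symmetries strip the casts from both sides; what remains is a whiskering by an
   identity. *)
- apply/eq2_opp/eq2_castl/eq2_sym/eq2_castl/eq2_sym.
  by apply: eq2_vcomp_idl; apply/eq2_eq; rewrite -(ten2_id (grayP C)).
- apply: eq2_castl; apply: eq2_vcomp_idl; apply/eq2_eq.
  by rewrite -(ten2_id (grayP C)).
- apply/eq2_opp/eq2_castl/eq2_sym/eq2_castl/eq2_sym.
  by apply: eq2_vcomp_idr; apply: eq2_refl.
Qed.

Lemma delta_v_asc a f g h l : exists e1 e2 e3,
  delta_v (asc_family a) (row4 f g h l) =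
    id2 f ⊗₂ a g h l - cast2 e1 e1 (a (f ⊗ g) h l)
    + cast2 e2 e2 (a f (g ⊗ h) l) - a f g (h ⊗ l)
    + cast2 e3 e3 (a f g h ⊗₂ id2 l).
Proof.
have A := tenA (grayP C).
exists (esym (A f g (h ⊗ l))), (congr1 (ten _ f) (esym (A g h l))).
have e : (f ⊗ (g ⊗ h)) ⊗ l = f ⊗ (g ⊗ (h ⊗ l)) by rewrite -!A.
exists e.
rewrite /delta_v !big_ord_recl big_ord0 addr0 !(exprS, expr0) !mulN1r !opprK.
rewrite !scaleN1r !scale1r !addrA.
have W (x y z : mor C) : id2 x ⊗₂ (id2 y ⊗₂ id2 z) ≡ id2 (x ⊗ (y ⊗ z)).
  by rewrite !(ten2_id (grayP C)); apply: eq2_refl.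
apply/eq2_eq; do 4?apply: eq2_add.
- by rewrite (vcomp1r (twocatP C)); apply: eq2_refl.
- apply/eq2_opp/eq2_castl/eq2_sym/eq2_castl/eq2_sym.
  exact: eq2_vcomp_idl (W (f ⊗ g) h l).
- apply/eq2_castl/eq2_sym/eq2_castl/eq2_sym.
  exact: eq2_vcomp_idl (W f (g ⊗ h) l).
- apply/eq2_opp/eq2_castl; exact: eq2_vcomp_idl (W f g (h ⊗ l)).
- apply/eq2_castl/eq2_sym/eq2_castl/eq2_sym.
  by apply: eq2_vcomp_idr; apply: eq2_refl.
Qed.

(** The positive terms linearize the left side of [tnr_cocycle], the negative ones its right
    side. *)
Lemma delta_h_tnr t f'' g'' f' g' f g cf' cg' cf cg : exists e1 e2,
  delta_h (tnr_family t) (@grid32 _ _ f'' g'' f' g' f g cf' cg' cf cg) =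
    tnr f'' g'' (f' ∘ f) (g' ∘ g) • (id2 (f'' ⊗ g'') ∘₂ t f' g' f g)
    - cast2 e1 e2
        (t (f'' ∘ f') (g'' ∘ g') f g • (tnr f'' g'' f' g' ∘₂ id2 (f ⊗ g)))
    + t f'' g'' (f' ∘ f) (g' ∘ g) • (id2 (f'' ⊗ g'') ∘₂ tnr f' g' f g)
    - cast2 e1 e2
        (tnr (f'' ∘ f') (g'' ∘ g') f g • (t f'' g'' f' g' ∘₂ id2 (f ⊗ g))).
Proof.
have A := Defs.compA (twocatP C).
have e1 : ((f'' ⊗ g'') ∘ (f' ⊗ g')) ∘ (f ⊗ g) =
    (f'' ⊗ g'') ∘ ((f' ⊗ g') ∘ (f ⊗ g)).
  by rewrite A //; apply: composable_ten.
have e2 : ((f'' ∘ f') ∘ f) ⊗ ((g'' ∘ g') ∘ g) =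
    (f'' ∘ (f' ∘ f)) ⊗ (g'' ∘ (g' ∘ g)) by rewrite !A.
exists e1, e2.
rewrite /delta_h !big_ord_recl big_ord0 addr0 !(exprS, expr0) !mulN1r !opprK.
rewrite !scaleN1r !scale1r !addrA.
have T := Theta_two (a := two f' g') (b := two f g) (composable_ten cf cg).
have T' := Theta_two (a := two f'' g'') (b := two f' g') (composable_ten cf' cg').
apply/eq2_eq; do 3?apply: eq2_add.
- apply: eq2_vcomp; last exact: eq2_refl.
  apply/eq2_eq/(Theta_two (a := two f'' g'') (b := two (f' ∘ f) (g' ∘ g))).
  by apply: composable_ten; apply: composable_compr.
- apply/eq2_opp/eq2_castl/eq2_sym/eq2_castl/eq2_sym.
  apply: eq2_vcomp; first exact: eq2_refl.
  by apply: eq2_hcomp; [apply/eq2_eq/T' | apply: eq2_refl].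
- apply/eq2_castl; apply: eq2_vcomp; first exact: eq2_refl.
  by apply: eq2_hcomp; [apply: eq2_refl | apply/eq2_eq/T].
- apply/eq2_opp/eq2_castl/eq2_sym/eq2_castl/eq2_sym.
  apply: eq2_vcomp; last exact: eq2_refl.
  apply/eq2_eq/(Theta_two (a := two (f'' ∘ f') (g'' ∘ g')) (b := two f g)).
  by apply: composable_ten; apply: composable_compl.
Qed.

Lemma delta_h_asc a f' g' h' f g h cf cg ch :
  let Θ := (id2 (f' ∘ f) ⊗₂ tnr g' h' g h) • tnr f' (g' ⊗ h') f (g ⊗ h) in
  delta_h (asc_family a) (@grid23 _ _ f' g' h' f g h cf cg ch) =
    Θ • (id2 (f' ⊗ (g' ⊗ h')) ∘₂ a f g h)
    - a (f' ∘ f) (g' ∘ g) (h' ∘ h) • Θ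
    + Θ • (a f' g' h' ∘₂ id2 (f ⊗ (g ⊗ h))).
Proof.
move=> Θ.
rewrite /delta_h big_ord_recl big_ord0 addr0 expr1 scaleN1r sqrrN expr1n scale1r.
have T : Theta (two (@three _ f' g' h' 3) (@three _ f g h 3)) = Θ.
  by apply: Theta_three; apply: three_pair.
apply/eq2_eq; apply: eq2_add; [apply: eq2_add|].
- by apply: eq2_vcomp; [apply/eq2_eq/T | apply: eq2_refl].
- apply/eq2_opp/eq2_castl/eq2_vcomp; [exact: eq2_refl | exact/eq2_eq/T].
- by apply/eq2_castl/eq2_vcomp; [apply/eq2_eq/T | apply: eq2_refl].
Qed.

(** The positive terms linearize the right side of [tnr_ten], the negative ones its left side. *)
Lemma delta_v_tnr t f' g' h' f g h cf cg ch : exists e1 e2,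
  delta_v (tnr_family t) (@grid23 _ _ f' g' h' f g h cf cg ch) =
    (id2 (f' ∘ f) ⊗₂ t g' h' g h) • tnr f' (g' ⊗ h') f (g ⊗ h)
    - cast2 e1 e2
        ((tnr f' g' f g ⊗₂ id2 (h' ∘ h)) • t (f' ⊗ g') h' (f ⊗ g) h)
    + (id2 (f' ∘ f) ⊗₂ tnr g' h' g h) • t f' (g' ⊗ h') f (g ⊗ h)
    - cast2 e1 e2
        ((t f' g' f g ⊗₂ id2 (h' ∘ h)) • tnr (f' ⊗ g') h' (f ⊗ g) h).
Proof.
have A := tenA (grayP C).
have e1 : ((f' ⊗ g') ⊗ h') ∘ ((f ⊗ g) ⊗ h) = (f' ⊗ (g' ⊗ h')) ∘ (f ⊗ (g ⊗ h)).
  by rewrite !A.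
exists e1, (esym (A _ _ _)).
rewrite /delta_v !big_ord_recl big_ord0 addr0 !(exprS, expr0) !mulN1r !opprK.
rewrite !scaleN1r !scale1r !addrA.
have Tl := Theta2_two (u := two f' f) (v := two g' g) (composable_ten cf cg).
have Tr := Theta2_two (u := two g' g) (v := two h' h) (composable_ten cg ch).
apply/eq2_eq; do 3?apply: eq2_add.
- apply: eq2_vcomp; first exact: eq2_refl.
  apply/eq2_eq/(Theta2_two (u := two f' f) (v := two (g' ⊗ h') (g ⊗ h))).
  by do ?apply: composable_ten.
- apply/eq2_opp/eq2_castl/eq2_sym/eq2_castl/eq2_sym.
  apply: eq2_vcomp; last exact: eq2_refl.
  by apply: eq2_ten2; [apply/eq2_eq/Tl | apply: eq2_refl].
- apply/eq2_castl; apply: eq2_vcomp; last exact: eq2_refl.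
  by apply: eq2_ten2; [apply: eq2_refl | apply/eq2_eq/Tr].
- apply/eq2_opp/eq2_castl/eq2_sym/eq2_castl/eq2_sym.
  apply: eq2_vcomp; first exact: eq2_refl.
  apply/eq2_eq/(Theta2_two (u := two (f' ⊗ g') (f ⊗ g)) (v := two h' h)).
  by do ?apply: composable_ten.
Qed.

End Differentials.

(** * The first order content of each deformation axiom *)

Section FirstOrder.
Variables (K : comPzRingType) (C : gray_semigroup K).
Implicit Types f g h l : mor C.
Local Notation tnr := (tnr (gray_str C)).

Lemma cast2D f g f' g' (ef : f = f') (eg : g = g') (σ τ : hom2 f g) :
  cast2 ef eg (σ + τ) = cast2 ef eg σ + cast2 ef eg τ.
Proof. by case: _ / ef; case: _ / eg. Qed.

Lemma eq2_castP f g f' g' (ef : f' = f) (eg : g' = g) (σ : hom2 f g)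
    (τ : hom2 f' g') :
  σ ≡ τ <-> σ = cast2 ef eg τ.
Proof. by case: _ / ef σ; case: _ / eg => σ; apply: eq2_eq. Qed.

Lemma eq2_iff f g f' g' (σ τ : hom2 f g) (σ' τ' : hom2 f' g') :
  σ ≡ σ' -> τ ≡ τ' -> σ = τ <-> σ' = τ'.
Proof.
by case=> ef [eg <-]; subst f' g' => /eq2_eq ->.
Qed.

Lemma pair_eqr (A B : Type) (x y : A) (u v : B) :
  x = y -> (x, u) = (y, v) <-> u = v.
Proof. by move=> ->; split=> [[]|->]. Qed.

Lemma subr_eq0P (V : zmodType) (x y : V) : x = y <-> x - y = 0.
Proof. by split=> [->|/eqP]; [rewrite subrr | rewrite subr_eq0 => /eqP]. Qed.

Lemma eq_symP (T : Type) (x y : T) : x = y <-> y = x.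
Proof. by split. Qed.

(** If τ inverts σ, then τ - (τ • σ1 • τ) ε inverts σ + σ1 ε. *)
Lemma invertible2e_first_order f g (σ : hom2e f g) :
  invertible2 σ.1 -> invertible2e σ.
Proof.
case: σ => σ σ1 /= [τ [τσ στ]].
exists (τ, - (τ • (σ1 • τ))); rewrite /vcompe /id2e /= τσ στ.
split; congr (_, _).
  by rewrite vcompNl -!(vcompA (twocatP C)) τσ (vcomp1r (twocatP C)) addrN.
by rewrite vcompNr (vcompA (twocatP C)) στ (vcomp1l (twocatP C)) addNr.
Qed.

Lemma invertible2_id f : invertible2 (id2 f).
Proof. by exists (id2 f); rewrite !(vcomp1l (twocatP C)). Qed.

Lemma invertible2_idto f g (e : f = g) : invertible2 (idto e).
Proof. by case: _ / e; apply: invertible2_id. Qed.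

Variable D : deformation_data C.
Local Notation t := (tnr1 D).
Local Notation A f g h := (idto (esym (tenA (grayP C) f g h))).

(** Casting the source makes the associator term an endomorphism of the right bracketed product,
    hence an element of X^(0,2). *)
Definition asc1_family f g h : hom2 (f ⊗ (g ⊗ h)) (f ⊗ (g ⊗ h)) :=
  cast2 (esym (tenA (grayP C) f g h)) erefl (asc1 D f g h).
Local Notation a := asc1_family.

Lemma asc1_familyE f g h : a f g h ≡ asc1 D f g h.
Proof. exact: eq2_cast. Qed.

Lemma eq2_asc f g h : A f g h ≡ id2 (f ⊗ (g ⊗ h)).
Proof. by apply/(eq2_trans (eq2_idto _))/eq2_id; rewrite (tenA (grayP C)). Qed.

(** In the ε coefficient, the terms where the perturbation falls on one of the four 2-morphisms
    cancel by naturality of the undeformed [tnr], so only their order zero parts survive. *)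
Lemma tnre_natP f' g' f g f1' g1' f1 g1
    (τ' : hom2e f' f1') (σ' : hom2e g' g1') (τ : hom2e f f1) (σ : hom2e g g1) :
  composable f' f -> composable g' g ->
  composable f1' f1 -> composable g1' g1 ->
  vcompe (tnre D f1' g1' f1 g1) (hcompe (ten2e τ' σ') (ten2e τ σ)) =
    vcompe (ten2e (hcompe τ' τ) (hcompe σ' σ)) (tnre D f' g' f g) <->
  t f1' g1' f1 g1 • ((τ'.1 ⊗₂ σ'.1) ∘₂ (τ.1 ⊗₂ σ.1)) =
    ((τ'.1 ∘₂ τ.1) ⊗₂ (σ'.1 ∘₂ σ.1)) • t f' g' f g.
Proof.
move=> cf cg cf1 cg1; have c := composable_ten cf cg.
case: τ' σ' τ σ => [τ' τ1'] [σ' σ1'] [τ τ1] [σ σ1].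
rewrite /vcompe /hcompe /ten2e /=.
rewrite (tnr_nat (grayP C)) //; apply: iff_trans (pair_eqr _ _ erefl) _.
rewrite (hcompDl _ _ _ c) (hcompDr _ _ _ c) !ten2Dl !ten2Dr !vcompDr !vcompDl.
rewrite !(tnr_nat (grayP C)) //.
set u := _ • _; set v := _ • _; set w := _ • _; set x := _ • _.
by rewrite [in RHS]addrC addrACA; split=> [/addrI|->].
Qed.

Lemma tnre_cocycleP f'' g'' f' g' f g (cf' : composable f'' f')
    (cg' : composable g'' g') (cf : composable f' f) (cg : composable g' g) :
  eq2e (vcompe (tnre D f'' g'' (f' ∘ f) (g' ∘ g))
               (hcompe (id2e (f'' ⊗ g'')) (tnre D f' g' f g)))
       (vcompe (tnre D (f'' ∘ f') (g'' ∘ g') f g)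
               (hcompe (tnre D f'' g'' f' g') (id2e (f ⊗ g)))) <->
  delta_h (tnr_family t) (grid32 cf' cg' cf cg) = 0.
Proof.
have c := composable_ten cf cg; have c' := composable_ten cf' cg'.
have [e1 [e2 ->]] := delta_h_tnr t cf' cg' cf cg.
rewrite /eq2e /vcompe /hcompe /id2e /=.
rewrite (hcomp0l _ _ (composable_compr c' c)) (hcomp0r _ _ (composable_compl c' c)).
rewrite addr0 add0r.
split=> [[_ /(eq2_castP e1 e2)]|E].
  rewrite cast2D => /subr_eq0P <-; rewrite opprD.
  by rewrite -!addrA; congr (_ + _); rewrite addrCA; congr (_ + _); rewrite addrC.
split; first by apply: (tnr_cocycle (grayP C)).
apply/(eq2_castP e1 e2)/subr_eq0P; rewrite cast2D -[RHS]E opprD.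
by rewrite -!addrA; congr (_ + _); rewrite addrCA; congr (_ + _); rewrite addrC.
Qed.

Lemma asce_natP f g h f1 g1 h1
    (ρ : hom2e f f1) (σ : hom2e g g1) (τ : hom2e h h1) :
  vcompe (asce D f1 g1 h1) (ten2e (ten2e ρ σ) τ) =
    vcompe (ten2e ρ (ten2e σ τ)) (asce D f g h) <->
  a f1 g1 h1 • (ρ.1 ⊗₂ (σ.1 ⊗₂ τ.1)) = (ρ.1 ⊗₂ (σ.1 ⊗₂ τ.1)) • a f g h.
Proof.
(* The undeformed associator is natural because the tensor product of 2-morphisms is strictly
   associative. *)
have N (u : hom2 f f1) (v : hom2 g g1) (w : hom2 h h1) :
    A f1 g1 h1 • ((u ⊗₂ v) ⊗₂ w) = (u ⊗₂ (v ⊗₂ w)) • A f g h.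
  apply/eq2_eq; apply: eq2_trans (eq2_vcomp_idl _ (eq2_asc _ _ _)) _.
  apply: eq2_trans (eq2_sym (ten2A (grayP C) _ _ _)) _.
  exact: eq2_sym (eq2_vcomp_idr _ (eq2_asc _ _ _)).
case: ρ σ τ => [ρ ρ1] [σ σ1] [τ τ1]; rewrite /vcompe /ten2e /= N.
apply: iff_trans (pair_eqr _ _ erefl) _.
rewrite !ten2Dl !ten2Dr !vcompDr !vcompDl !N.
set u := _ • _; set v := _ • _; set w := _ • _.
rewrite [RHS]addrC addrA.
have Q : asc1 D f1 g1 h1 • ((ρ ⊗₂ σ) ⊗₂ τ) = (ρ ⊗₂ (σ ⊗₂ τ)) • asc1 D f g h <->
    a f1 g1 h1 • (ρ ⊗₂ (σ ⊗₂ τ)) = (ρ ⊗₂ (σ ⊗₂ τ)) • a f g h.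
  apply: eq2_iff; apply: eq2_vcomp.
  - exact: eq2_sym (asc1_familyE _ _ _).
  - exact: eq2_sym (ten2A (grayP C) _ _ _).
  - exact: eq2_refl.
  - exact: eq2_sym (asc1_familyE _ _ _).
by apply: iff_trans Q; split=> [/addrI|->].
Qed.

(** Puts the first order expansion, right side minus left side, in the order of the summands of
    [delta_h] and [delta_v]. *)
Let sub_shuffle7 (V : zmodType) (l1 l2 l3 r1 r2 r3 r4 : V) :
  r1 + (r2 + (r4 + r3)) - (l2 + (l3 + l1)) = r1 - l1 + r2 + (r3 - l2 + r4 - l3).
Proof.
rewrite !opprD !addrA.
by rewrite (AC 7 (1*7*2*4*5*3*6)).
Qed.

(** Both differentials meet in X^(1,2): perturbing the associators gives the three terms of
    [delta_h], perturbing the tensorators the four terms of [delta_v]. The order zero parts agree by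
    [tnr_ten]. *)
Lemma asce_tnreP f' g' h' f g h (cf : composable f' f) (cg : composable g' g)
    (ch : composable h' h) :
  vcompe (vcompe (asce D (f' ∘ f) (g' ∘ g) (h' ∘ h))
      (ten2e (tnre D f' g' f g) (id2e (h' ∘ h))))
    (tnre D (f' ⊗ g') h' (f ⊗ g) h) =
  vcompe (vcompe (vcompe (ten2e (id2e (f' ∘ f)) (tnre D g' h' g h))
        (tnre D f' (g' ⊗ h') f (g ⊗ h)))
      (hcompe (asce D f' g' h') (id2e (f ⊗ (g ⊗ h)))))
    (hcompe (id2e ((f' ⊗ g') ⊗ h')) (asce D f g h)) <->
  delta_h (asc_family a) (grid23 cf cg ch)
    + delta_v (tnr_family t) (grid23 cf cg ch) = 0.
Proof.
have cr : composable (f' ⊗ (g' ⊗ h')) (f ⊗ (g ⊗ h)).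
  by do ?apply: composable_ten.
have cl : composable ((f' ⊗ g') ⊗ h') (f ⊗ (g ⊗ h)).
  by rewrite -(tenA (grayP C)).
have cll : composable ((f' ⊗ g') ⊗ h') ((f ⊗ g) ⊗ h).
  by do ?apply: composable_ten.
have [e1 [e2 ->]] := delta_v_tnr t cf cg ch; rewrite delta_h_asc.
set Θ := (id2 (f' ∘ f) ⊗₂ tnr g' h' g h) • _.
set Ξ := (tnr f' g' f g ⊗₂ id2 (h' ∘ h)) • tnr (f' ⊗ g') h' (f ⊗ g) h.
have ΞΘ : Ξ ≡ Θ by apply: (tnr_ten (grayP C)).
have I : id2 ((f' ⊗ g') ⊗ h') ≡ id2 (f' ⊗ (g' ⊗ h')).
  by apply: eq2_id; rewrite (tenA (grayP C)).
have Hl : A f' g' h' ∘₂ id2 (f ⊗ (g ⊗ h)) ≡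
    id2 ((f' ⊗ (g' ⊗ h')) ∘ (f ⊗ (g ⊗ h))).
  rewrite -(hcomp_id (twocatP C) cr).
  by apply: eq2_hcomp (eq2_asc _ _ _) (eq2_refl _).
have Hr : id2 ((f' ⊗ g') ⊗ h') ∘₂ A f g h ≡
    id2 ((f' ⊗ (g' ⊗ h')) ∘ (f ⊗ (g ⊗ h))).
  rewrite -(hcomp_id (twocatP C) cr).
  by apply: eq2_hcomp (eq2_asc _ _ _).
rewrite /vcompe /hcompe /ten2e /id2e /=.
apply: iff_trans (pair_eqr _ _ _) _.
  apply/eq2_eq; rewrite -(vcompA (twocatP C)).
  apply: eq2_trans (eq2_vcomp_idl _ (eq2_asc _ _ _)) _.
  apply: eq2_trans ΞΘ _; apply: eq2_sym.
  apply: eq2_trans (eq2_vcomp_idr _ Hr) _.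
  exact: eq2_trans (eq2_vcomp_idr _ Hl) (eq2_refl _).
rewrite ten20r ten20l (hcomp0l _ _ cll) (hcomp0r _ _ cl) !(add0r, addr0).
(* The sides are exchanged first: right minus left has the signs of the differential. *)
apply: iff_trans (@eq_symP _ _ _) (iff_trans (@subr_eq0P _ _ _) _).
rewrite !(vcompDl, vcompDr) sub_shuffle7.
have Ea := asc1_familyE.
apply: eq2_0; apply: eq2_add; [do 2?apply: eq2_add | do 3?apply: eq2_add].
- apply: eq2_vcomp; first exact: eq2_vcomp_idr Hl.
  exact: eq2_hcomp I (eq2_sym (Ea _ _ _)).
- rewrite -(vcompA (twocatP C)); apply: eq2_opp.
  exact: eq2_vcomp (eq2_sym (Ea _ _ _)) ΞΘ.
- apply: eq2_trans (eq2_vcomp_idr _ Hr) _.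
  apply: eq2_vcomp; first exact: eq2_refl.
  exact: eq2_hcomp (eq2_sym (Ea _ _ _)) (eq2_refl _).
- by apply: eq2_trans (eq2_vcomp_idr _ Hr) _; apply: eq2_vcomp_idr Hl.
- rewrite -(vcompA (twocatP C)); apply/eq2_opp/eq2_sym/eq2_castl/eq2_sym.
  exact: eq2_vcomp_idl (eq2_asc _ _ _).
- by apply: eq2_trans (eq2_vcomp_idr _ Hr) _; apply: eq2_vcomp_idr Hl.
- rewrite -(vcompA (twocatP C)); apply/eq2_opp/eq2_sym/eq2_castl/eq2_sym.
  exact: eq2_vcomp_idl (eq2_asc _ _ _).
Qed.

Let sub_shuffle5 (V : zmodType) (l1 l2 r1 r2 r3 : V) :
  r3 + (r2 + r1) - (l1 + l2) = r1 - l1 + r2 - l2 + r3.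
Proof.
rewrite !opprD !addrA.
by rewrite (AC 5 (3*4*2*5*1)).
Qed.

(** At order zero all five associators are identities up to casts; perturbing each in turn gives the
    five summands of [delta_v] in X^(0,3). *)
Lemma asce_pentagonP f g h l :
  vcompe (asce D f g (h ⊗ l)) (asce D (f ⊗ g) h l) =
  vcompe (vcompe (ten2e (id2e f) (asce D g h l)) (asce D f (g ⊗ h) l))
    (ten2e (asce D f g h) (id2e l)) <->
  delta_v (asc_family a) (row4 f g h l) = 0.
Proof.
have [e1 [e2 [e3 ->]]] := delta_v_asc a f g h l.
rewrite /vcompe /ten2e /id2e /=.
have tA := tenA (grayP C).
have H1 : A f g (h ⊗ l) ≡ id2 (f ⊗ (g ⊗ (h ⊗ l))) := eq2_asc _ _ _.
have H2 : A (f ⊗ g) h l ≡ id2 (f ⊗ (g ⊗ (h ⊗ l))).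
  by apply: eq2_trans (eq2_asc _ _ _) (eq2_id _); rewrite !tA.
have H3 : id2 f ⊗₂ A g h l ≡ id2 (f ⊗ (g ⊗ (h ⊗ l))).
  rewrite -(ten2_id (grayP C)).
  by apply: eq2_ten2; [apply: eq2_refl | apply: eq2_asc].
have H4 : A f (g ⊗ h) l ≡ id2 (f ⊗ (g ⊗ (h ⊗ l))).
  by apply: eq2_trans (eq2_asc _ _ _) (eq2_id _); rewrite !tA.
have H5 : A f g h ⊗₂ id2 l ≡ id2 (f ⊗ (g ⊗ (h ⊗ l))).
  apply: eq2_trans (eq2_ten2 (eq2_asc _ _ _) (eq2_refl _)) _.
  by rewrite (ten2_id (grayP C)); apply: eq2_id; rewrite !tA.
apply: iff_trans (pair_eqr _ _ _) _.
  apply/eq2_eq/(eq2_trans (eq2_vcomp_idl _ H1))/(eq2_trans H2)/eq2_sym.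
  apply: eq2_trans (eq2_vcomp_idr _ H5) _.
  exact: eq2_trans (eq2_vcomp_idl _ H3) H4.
rewrite ten20r ten20l !(add0r, addr0).
apply: iff_trans (@eq_symP _ _ _) (iff_trans (@subr_eq0P _ _ _) _).
rewrite !(vcompDl, vcompDr) sub_shuffle5.
have Ea f0 g0 h0 := eq2_sym (asc1_familyE f0 g0 h0).
apply: eq2_0; do 4?apply: eq2_add.
- apply: eq2_trans (eq2_vcomp_idr _ H5) _.
  apply: eq2_trans (eq2_vcomp_idr _ H4) _.
  exact: eq2_ten2 (eq2_refl _) (Ea _ _ _).
- apply/eq2_opp/eq2_sym/eq2_castl/eq2_sym.
  exact: eq2_trans (eq2_vcomp_idl _ H1) (Ea _ _ _).
- apply/eq2_sym/eq2_castl/eq2_sym/(eq2_trans (eq2_vcomp_idr _ H5)).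
  exact: eq2_trans (eq2_vcomp_idl _ H3) (Ea _ _ _).
- apply/eq2_opp; exact: eq2_trans (eq2_vcomp_idr _ H2) (Ea _ _ _).
- apply/eq2_sym/eq2_castl/eq2_sym.
  apply: eq2_trans (eq2_vcomp_idl _ _) (eq2_ten2 (Ea _ _ _) (eq2_refl _)).
  exact: eq2_trans (eq2_vcomp_idl _ H3) H4.
Qed.

End FirstOrder.

(** * Deformations as cochains of the total complex *)

Section Cochains.
Variables (K : comPzRingType) (C : gray_semigroup K).
Implicit Types f g h l : mor C.
Local Notation tnr := (tnr (gray_str C)).
Local Notation i1 := (lift ord0 ord0).
Local Notation i2 := (lift ord0 i1).

Definition deformation_cochain (D : deformation_data C) : cochain C :=
  fun m n => match m, n return Defs.family C m n with
  | 1, 1 => tnr_family (tnr1 D)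
  | 0, 2 => asc_family (asc1_family D)
  | _, _ => fun=> 0
  end.

Definition psi_cochain (p : forall f g, hom2 (f ⊗ g) (f ⊗ g)) : cochain C :=
  fun m n => match m, n return Defs.family C m n with
  | 0, 1 => psi_family p
  | _, _ => fun=> 0
  end.

Lemma delta_h0 m n (F : grid C m.+1 n) :
  delta_h ((fun=> 0) : Defs.family C m n) F = 0.
Proof.
have := delta_hB ((fun=> 0) : Defs.family C m n) (fun=> 0) F.
rewrite subrr => <-; congr (delta_h _ F).
by apply: functional_extensionality_dep => G; rewrite subr0.
Qed.

Lemma delta_v0 m n (F : grid C m n.+1) :
  delta_v ((fun=> 0) : Defs.family C m n) F = 0.
Proof.
have := delta_vB ((fun=> 0) : Defs.family C m n) (fun=> 0) F.
rewrite subrr => <-; congr (delta_v _ F).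
by apply: functional_extensionality_dep => G; rewrite subr0.
Qed.

(** Each component of [delta] reads [x] one step lower in one direction, where [x] vanishes outside
    its total degree. Equations on [delta] then need checking only in finitely many bidegrees. *)
Lemma delta_out q (x : cochain C) m n (F : grid C m n) :
  tot q x -> ~~ ((m + n == q.+1) && (0 < n))%N -> delta x F = 0.
Proof.
move=> tx out; rewrite /delta.
have -> : delta_h_part x F = 0.
  case: m F out => [|m] F out //=.
  have [_ _ ->] := tx m n; first by rewrite delta_h0 scaler0.
  by apply: contra out; rewrite addSn eqSS.
rewrite add0r; case: n F out => [|n] F out //=.
have [_ _ ->] := tx m n; first exact: delta_v0.
by apply: contra out; rewrite addnS eqSS andbT => /andP[].
Qed.

(** Matching on the value of [k] inside the return type makes the endpoints reduce together with
    [two]. *)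
Definition two2 f g f1 g1 (τ : hom2 f f1) (σ : hom2 g g1) (k : 'I_2) :
    hom2 (two f g k) (two f1 g1 k) :=
  match nat_of_ord k as n return
    hom2 (if n is 0 then f else g) (if n is 0 then f1 else g1)
  with 0 => τ | _.+1 => σ end.

Definition three2 f g h f1 g1 h1 (ρ : hom2 f f1) (σ : hom2 g g1) (τ : hom2 h h1)
    (k : 'I_3) : hom2 (three f g h k) (three f1 g1 h1 k) :=
  match nat_of_ord k as n return
    hom2 (match n with 0 => f | 1 => g | _ => h end)
         (match n with 0 => f1 | 1 => g1 | _ => h1 end)
  with 0 => ρ | 1 => σ | _ => τ end.

Definition twotwo2 f' g' f g f1' g1' f1 g1 (τ' : hom2 f' f1') (σ' : hom2 g' g1')
    (τ : hom2 f f1) (σ : hom2 g g1) (j k : 'I_2) :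
    hom2 (two (two f' g') (two f g) j k) (two (two f1' g1') (two f1 g1) j k) :=
  match nat_of_ord j as n return
    hom2 ((if n is 0 then two f' g' else two f g) k)
         ((if n is 0 then two f1' g1' else two f1 g1) k)
  with 0 => two2 τ' σ' k | _.+1 => two2 τ σ k end.

Lemma natural_psiP p : natural (psi_family p) <->
  forall f g f1 g1 (τ : hom2 f f1) (σ : hom2 g g1),
    p f1 g1 • (τ ⊗₂ σ) = (τ ⊗₂ σ) • p f g.
Proof.
split=> [N f g f1 g1 τ σ | N F F' σ]; last exact: N.
exact: (N (row2 f g) (row2 f1 g1) (fun _ => two2 τ σ)).
Qed.

Lemma natural_ascP a : natural (asc_family a) <->
  forall f g h f1 g1 h1 (ρ : hom2 f f1) (σ : hom2 g g1) (τ : hom2 h h1),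
    a f1 g1 h1 • (ρ ⊗₂ (σ ⊗₂ τ)) = (ρ ⊗₂ (σ ⊗₂ τ)) • a f g h.
Proof.
split=> [N f g h f1 g1 h1 ρ σ τ | N F F' σ]; last exact: N.
exact: (N (row3 f g h) (row3 f1 g1 h1) (fun _ => three2 ρ σ τ)).
Qed.

Lemma natural_tnrP t : natural (tnr_family t) <->
  forall f' g' f g f1' g1' f1 g1
    (τ' : hom2 f' f1') (σ' : hom2 g' g1') (τ : hom2 f f1) (σ : hom2 g g1),
    composable f' f -> composable g' g ->
    composable f1' f1 -> composable g1' g1 ->
    t f1' g1' f1 g1 • ((τ' ⊗₂ σ') ∘₂ (τ ⊗₂ σ)) =
    ((τ' ∘₂ τ) ⊗₂ (σ' ∘₂ σ)) • t f' g' f g.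
Proof.
split=> [N f' g' f g f1' g1' f1 g1 τ' σ' τ σ cf cg cf1 cg1 | N F F' σ].
  exact: (N (grid22 cf cg) (grid22 cf1 cg1) (twotwo2 τ' σ' τ σ)).
by apply: N; apply: grid_composable.
Qed.

Lemma special_psiP p : @special K C 0 1 (psi_family p) <->
  forall X Y, p (idm X) (idm Y) = 0.
Proof.
split=> [S X Y | S]; first by apply: (S (row2 _ _) ord0) => -[[|k] ltk];
  [exists X | exists Y].
elim/row2_ind => f g j id_j.
have [X EX] : exists X, f = idm X := id_j ord0.
have [Y EY] : exists Y, g = idm Y := id_j i1.
by change (p f g = 0); rewrite EX EY.
Qed.

Lemma special_ascP a : @special K C 0 2 (asc_family a) <->
  forall X Y Z, a (idm X) (idm Y) (idm Z) = 0.
Proof.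
split=> [S X Y Z | S].
  by apply: (S (row3 _ _ _) ord0) => -[[|[|k]] ltk]; [exists X|exists Y|exists Z].
elim/row3_ind => f g h j id_j.
have [X EX] : exists X, f = idm X := id_j ord0.
have [Y EY] : exists Y, g = idm Y := id_j i1.
have [Z EZ] : exists Z, h = idm Z := id_j i2.
by change (a f g h = 0); rewrite EX EY EZ.
Qed.

(** A row of identities may sit on arbitrary objects, but composability with the other row forces
    these to be its codomains or domains, as in the unit axioms of the tensorator. *)
Lemma special_tnrP t : @special K C 1 1 (tnr_family t) <->
  (forall f g, t (idm (cod f)) (idm (cod g)) f g = 0) /\
  (forall f g, t f g (idm (dom f)) (idm (dom g)) = 0).
Proof.
have dom1 := dom_id (twocatP C); have cod1 := cod_id (twocatP C).
split=> [S | [Sl Sr]].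
  split=> f g.
    have c h : composable (idm (cod h)) h by exact: dom1.
    apply: (S (grid22 (c f) (c g)) ord0) => -[[|k] ltk];
      [by exists (cod f) | by exists (cod g)].
  have c h : composable h (idm (dom h)) by rewrite /composable cod1.
  apply: (S (grid22 (c f) (c g)) ord_max) => -[[|k] ltk];
    [by exists (dom f) | by exists (dom g)].
elim/grid22_ind => f' g' f g cf cg [[|j] ltj] id_j.
  have [X EX] : exists X, f' = idm X := id_j ord0.
  have [Y EY] : exists Y, g' = idm Y := id_j i1.
  have Ef : f' = idm (cod f) by rewrite -cf EX dom1.
  have Eg : g' = idm (cod g) by rewrite -cg EY dom1.
  by change (t f' g' f g = 0); rewrite Ef Eg.
have [X EX] : exists X, f = idm X.
  by case: j ltj id_j => [|j] // ltj id_j; apply: (id_j ord0).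
have [Y EY] : exists Y, g = idm Y.
  by case: j ltj id_j => [|j] // ltj id_j; apply: (id_j i1).
have Ef : f = idm (dom f') by rewrite cf EX cod1.
have Eg : g = idm (dom g') by rewrite cg EY cod1.
by change (t f' g' f g = 0); rewrite Ef Eg.
Qed.

Lemma tot1_psi p : tot 1 (psi_cochain p) <->
  (forall f g f1 g1 (τ : hom2 f f1) (σ : hom2 g g1),
     p f1 g1 • (τ ⊗₂ σ) = (τ ⊗₂ σ) • p f g) /\
  (forall X Y, p (idm X) (idm Y) = 0).
Proof.
rewrite -natural_psiP -special_psiP; split=> [T | [N S] m n].
  by have [N S _] := T 0 1.
have [N0 S0 _] := @tot0 K C 0 m n.
by case: m n N0 S0 => [|m] [|[|n]].
Qed.

Lemma tot2_deformation D : tot 2 (deformation_cochain D) <->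
  [/\ natural (tnr_family (tnr1 D)), @special K C 1 1 (tnr_family (tnr1 D)),
    natural (asc_family (asc1_family D)) &
    @special K C 0 2 (asc_family (asc1_family D))].
Proof.
split=> [T | [Nt St Na Sa] m n].
  by have [? ? _] := T 1 1; have [? ? _] := T 0 2.
have [N0 S0 _] := @tot0 K C 0 m n.
by case: m n N0 S0 => [|[|m]] [|[|[|n]]].
Qed.

(** Naturality and the unit axioms amount to membership in [tot 2]; the cocycle identity, the
    associator-tensorator identity and the pentagon amount to the components of [delta] in X^(2,1),
    X^(1,2) and X^(0,3). *)
Lemma deformation_lawsP D : deformation_laws D <->
  tot 2 (deformation_cochain D) /\ delta (deformation_cochain D) = 0.
Proof.
split=> [L | [T dD]].
  have T : tot 2 (deformation_cochain D).
    apply/tot2_deformation; split.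
    - apply/natural_tnrP => f' g' f g f1' g1' f1 g1 τ' σ' τ σ cf cg cf1 cg1.
      (* 2-morphisms of [C] are tested inside C_ε with zero ε part. *)
      have := tnre_nat L (τ', 0) (σ', 0) (τ, 0) (σ, 0) cf cg cf1 cg1.
      by move/(tnre_natP D _ _ _ _ cf cg cf1 cg1).
    - apply/special_tnrP; split=> f g.
        by have [_ /eq2_0l] := tnre_idl L f g.
      by have [_ /eq2_0l] := tnre_idr L f g.
    - apply/natural_ascP => f g h f1 g1 h1 ρ σ τ.
      have := asce_nat L (ρ, 0) (σ, 0) (τ, 0).
      by move/asce_natP.
    - apply/special_ascP => X Y Z.
      have [_ /eq2_0l E] := asce_id L X Y Z.
      by apply/(eq2_0 (asc1_familyE D _ _ _)).
  split=> //; apply: cochainP => m n F; rewrite -[RHS]/0.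
  case O: ((m + n == 3) && (0 < n))%N; last by rewrite (delta_out _ T) ?O.
  case: n F O => [|n] F; first by rewrite andbF.
  rewrite addnS; case: m n F => [|[|[|m]]] [|[|[|n]]] // F _; rewrite /delta.
  - elim/row4_ind: F => f g h l; rewrite add0r.
    exact/asce_pentagonP/asce_pentagon.
  - elim/grid23_ind: F => f' g' h' f g h cf cg ch.
    rewrite /delta_h_part sqrrN expr1n scale1r.
    by apply/asce_tnreP; apply: asce_tnre.
  - elim/grid32_ind: F => f'' g'' f' g' f g cf' cg' cf cg.
    (* The X^(2,0) contribution is zero, and the sign (-1)^n with n = 1 does not affect
       vanishing. *)
    rewrite /delta_v_part delta_v0 addr0 /delta_h_part expr1 scaleN1r.
    apply/eqP; rewrite oppr_eq0; apply/eqP.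
    by apply/tnre_cocycleP; apply: tnre_cocycle.
have [/natural_tnrP Nt /special_tnrP[Stl Str] /natural_ascP Na /special_ascP Sa] :=
  (tot2_deformation D).1 T.
have E m n (F : grid C m n) : delta (deformation_cochain D) F = 0 by rewrite dD.
(* Zero morphisms are related by [≡] only when their boundaries agree; the order zero unit laws
   supply that agreement. *)
have zero2 f g f' g' (σ : hom2 f g) (τ : hom2 f' g') :
    σ ≡ τ -> (0 : hom2 f g) ≡ (0 : hom2 f' g').
  by case=> ef [eg _]; apply: eq2_00.
split.
- by move=> f' g' f g cf cg; apply/invertible2e_first_order/(tnr_iso (grayP C)).
- move=> f' g' f g f1' g1' f1 g1 τ' σ' τ σ cf cg cf1 cg1.
  by apply/tnre_natP => //; apply: Nt.
- move=> f'' g'' f' g' f g cf' cg' cf cg.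
  apply/(tnre_cocycleP D cf' cg' cf cg).
  have := E _ _ (grid32 cf' cg' cf cg).
  rewrite /delta /delta_v_part delta_v0 addr0 /delta_h_part expr1 scaleN1r.
  by move/eqP; rewrite oppr_eq0 => /eqP.
- move=> f g; have I := tnr_idl (grayP C) f g; split=> //=.
  by rewrite Stl; apply: zero2 I.
- move=> f g; have I := tnr_idr (grayP C) f g; split=> //=.
  by rewrite Str; apply: zero2 I.
- by move=> f g h; apply/invertible2e_first_order/invertible2_idto.
- by move=> f g h f1 g1 h1 ρ σ τ; apply/asce_natP/Na.
- move=> X Y Z; have I := eq2_asc (idm X) (idm Y) (idm Z); split=> //=.
  have /(eq2_0 (asc1_familyE D _ _ _)) -> := Sa X Y Z.
  exact: zero2 I.
- move=> f' g' h' f g h cf cg ch; apply/(asce_tnreP D cf cg ch).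
  have := E _ _ (grid23 cf cg ch).
  by rewrite /delta /delta_h_part sqrrN expr1n scale1r.
- move=> f g h l; apply/asce_pentagonP.
  by have := E _ _ (row4 f g h l); rewrite /delta add0r.
Qed.

(** A cochain is evaluated on grids, which carry composability proofs, while [tnr1] takes arbitrary
    1-morphisms. The value 0 off composable pairs is the one imposed by [tnr1_default]. *)
Definition cochain_deformation_data (x : cochain C) : deformation_data C.
Proof.
pose t f' g' f g : hom2 ((f' ⊗ g') ∘ (f ⊗ g)) ((f' ∘ f) ⊗ (g' ∘ g)) :=
  match pselect (composable f' f /\ composable g' g) with
  | left c => x 1 1 (grid22 c.1 c.2)
  | right _ => 0
  end.
pose a f g h : hom2 ((f ⊗ g) ⊗ h) (f ⊗ (g ⊗ h)) :=
  cast2 (tenA (grayP C) f g h) erefl (x 0 2 (row3 f g h)).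
apply: (@DeformationData _ _ t a) => f' g' f g n.
by rewrite /t; case: pselect.
Defined.

Lemma cochain_deformation_dataK x : tot 2 x ->
  deformation_cochain (cochain_deformation_data x) = x.
Proof.
move=> Tx; set D := cochain_deformation_data x.
have E11 (F : grid C 1 1) : deformation_cochain D F = x 1 1 F.
  elim/grid22_ind: F => f' g' f g cf cg; rewrite /= /tnr_family /=.
  case: pselect => [c|[]//]; rewrite (Prop_irrelevance cf c.1).
  by rewrite (Prop_irrelevance cg c.2).
have E02 (F : grid C 0 2) : deformation_cochain D F = x 0 2 F.
  elim/row3_ind: F => f g h.
  by apply/eq2_eq/eq2_castl/eq2_castl/eq2_refl.
apply: cochainP => m n F.
case O: ((m + n == 2) && (0 < n))%N; last first.
  have [_ _ ->] := Tx m n; last by rewrite O.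
  by case: m n F O => [|[|m]] [|[|[|n]]].
case: n F O => [|n] F; first by rewrite andbF.
by rewrite addnS; case: m n F => [|[|m]] [|[|n]].
Qed.

(** * The first order content of ψ-equivalence *)

Section PsiEquivalence.
Variables (D D' : deformation_data C) (p : forall f g, hom2 (f ⊗ g) (f ⊗ g)).
Local Notation psi f g := ((id2 (f ⊗ g), p f g) : hom2e (f ⊗ g) (f ⊗ g)).

Lemma psi_natP f g f1 g1 (τ : hom2e f f1) (σ : hom2e g g1) :
  vcompe (psi f1 g1) (ten2e τ σ) = vcompe (ten2e τ σ) (psi f g) <->
  p f1 g1 • (τ.1 ⊗₂ σ.1) = (τ.1 ⊗₂ σ.1) • p f g.
Proof.
rewrite /vcompe /= !(vcomp1l (twocatP C)) !(vcomp1r (twocatP C)).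
apply: iff_trans (pair_eqr _ _ erefl) _.
by rewrite [RHS]addrC; split=> [/addrI|->].
Qed.

Let sub_shuffle_tnr (V : zmodType) (u v x y z : V) :
  u + x - (y + (z + v)) = - (y - x + z) + (u - v).
Proof.
rewrite !opprD opprK !addrA.
by rewrite (AC 5 (3*2*4*1*5)).
Qed.

(** The minus sign is the factor (-1)^n, with n = 1, of [delta_h] in the total differential. *)
Lemma psi_tnreP f' g' f g (cf : composable f' f) (cg : composable g' g) :
  vcompe (psi (f' ∘ f) (g' ∘ g)) (tnre D f' g' f g) =
    vcompe (vcompe (tnre D' f' g' f g) (hcompe (psi f' g') (id2e (f ⊗ g))))
      (hcompe (id2e (f' ⊗ g')) (psi f g)) <->
  - delta_h (psi_family p) (grid22 cf cg) = tnr1 D' f' g' f g - tnr1 D f' g' f g.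
Proof.
have c := composable_ten cf cg.
rewrite delta_h_psi /vcompe /hcompe /id2e /= (hcomp_id (twocatP C) c).
rewrite !(vcomp1l (twocatP C)) !(vcomp1r (twocatP C)).
apply: iff_trans (pair_eqr _ _ erefl) _.
rewrite (hcomp0l _ _ c) (hcomp0r _ _ c) !(add0r, addr0).
apply: iff_trans (@subr_eq0P _ _ _) (iff_trans _ (iff_sym (@subr_eq0P _ _ _))).
by rewrite opprB -sub_shuffle_tnr.
Qed.

Let sub_shuffle_asc (V : zmodType) (u v x y z w : V) :
  u + (z + x) - (y + (w + v)) = x - y + z - w + (u - v).
Proof.
rewrite !opprD !addrA.
by rewrite (AC 6 (3*4*2*5*1*6)).
Qed.

(** The undeformed associators act as identities up to casts, so the four perturbed occurrences of ψ
    give the four summands of [delta_v]. *)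
Lemma psi_asceP f g h :
  vcompe (vcompe (ten2e (id2e f) (psi g h)) (psi f (g ⊗ h))) (asce D f g h) =
    vcompe (vcompe (asce D' f g h) (ten2e (psi f g) (id2e h))) (psi (f ⊗ g) h) <->
  delta_v (psi_family p) (row3 f g h) = asc1_family D' f g h - asc1_family D f g h.
Proof.
have [e1 [e2 ->]] := delta_v_psi p f g h.
rewrite /vcompe /ten2e /id2e /= !(ten2_id (grayP C)).
rewrite !(vcomp1l (twocatP C)) !(vcomp1r (twocatP C)).
apply: iff_trans (pair_eqr _ _ erefl) _.
rewrite ten20l ten20r !(add0r, addr0).
apply: iff_trans (@subr_eq0P _ _ _) (iff_trans _ (iff_sym (@subr_eq0P _ _ _))).
rewrite opprB vcompDl sub_shuffle_asc.
have Ea E f0 g0 h0 := eq2_sym (asc1_familyE E f0 g0 h0).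
apply: eq2_0; apply: eq2_add; last exact: eq2_add (Ea _ _ _ _) (eq2_opp (Ea _ _ _ _)).
do 3?apply: eq2_add.
- exact: eq2_vcomp_idr (eq2_asc _ _ _).
- apply/eq2_opp/eq2_sym/eq2_castl/eq2_sym.
  exact: eq2_vcomp_idl (eq2_asc _ _ _).
- exact: eq2_vcomp_idr (eq2_asc _ _ _).
- apply/eq2_opp/eq2_sym/eq2_castl/eq2_sym.
  exact: eq2_vcomp_idl (eq2_asc _ _ _).
Qed.

End PsiEquivalence.
End Cochains.

(** * Classes of deformations and the second cohomology group *)

Section Classification.
Variables (K : comPzRingType) (C : gray_semigroup K).
Implicit Types D : deformation C.

(** The only bidegree of total degree 1 with n positive is (0,1), so every 1-cochain is a candidate
    for ψ. *)
Lemma psi_cochainK (y : cochain C) : tot 1 y ->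
  psi_cochain (fun f g => y 0 1 (row2 f g)) = y.
Proof.
move=> Ty; apply: cochainP => m n F.
case O: ((m + n == 1) && (0 < n))%N; last first.
  have [_ _ ->] := Ty m n; last by rewrite O.
  by case: m n F O => [|m] [|[|n]].
case: n F O => [|n] F; first by rewrite andbF.
rewrite addnS; case: m n F => [|m] [|n] // F _.
by elim/row2_ind: F.
Qed.

Lemma psi_equivalentP D D' : psi_equivalent D D' <->
  exists2 y : cochain C, tot 1 y &
    delta y = deformation_cochain D' - deformation_cochain D.
Proof.
have [TD _] := (deformation_lawsP D).1 (deformationP D).
have [TD' _] := (deformation_lawsP D').1 (deformationP D').
split=> [[p [_ Np Ip Tp Ap]] | [y Ty]].
  have Ty : tot 1 (psi_cochain p).
    apply/tot1_psi; split=> [f g f1 g1 τ σ | X Y]; last by case: (Ip X Y).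
    by have /psi_natP := Np _ _ _ _ (τ, 0) (σ, 0).
  exists (psi_cochain p) => //; apply: cochainP => m n F.
  rewrite -[RHS]/(deformation_cochain D' F - deformation_cochain D F).
  case O: ((m + n == 2) && (0 < n))%N; last first.
    rewrite (delta_out _ Ty) ?O //.
    have [_ _ ->] := TD m n; last by rewrite O.
    by have [_ _ ->] := TD' m n; rewrite ?O // subr0.
  case: n F O => [|n] F; first by rewrite andbF.
  rewrite addnS; case: m n F => [|[|m]] [|[|n]] // F _; rewrite /delta.
  - rewrite add0r; elim/row3_ind: F => f g h.
    exact/psi_asceP.
  - elim/grid22_ind: F => f' g' f g cf cg.
    rewrite /delta_v_part delta_v0 addr0 /delta_h_part expr1 scaleN1r.
    by apply/psi_tnreP; apply: Tp.
(* The given 1-cochain is itself the first order part of the required ψ. *)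
have [p Ey] : exists p, psi_cochain p = y by eexists; apply: psi_cochainK Ty.
subst y => dy.
have [Np Ip] := (tot1_psi p).1 Ty.
have E m n (F : grid C m n) : delta (psi_cochain p) F =
    deformation_cochain D' F - deformation_cochain D F by rewrite dy.
exists p; split.
- by move=> f g; apply/invertible2e_first_order/invertible2_id.
- by move=> f g f1 g1 τ σ; apply/psi_natP/Np.
- by move=> X Y; rewrite Ip.
- move=> f' g' f g cf cg; apply/(psi_tnreP _ _ _ cf cg).
  rewrite -[RHS](E _ _ (grid22 cf cg)).
  by rewrite /delta /delta_v_part delta_v0 addr0 /delta_h_part expr1 scaleN1r.
- move=> f g h; apply/psi_asceP; rewrite -[RHS](E _ _ (row3 f g h)).
  by rewrite /delta add0r.
Qed.

Fact deformation_cochain_cocycle D : deformation_cochain D \in @is_cocycle K C 2.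
Proof. exact/asboolP/deformation_lawsP/deformationP. Qed.

Definition deformation_cocycle D : cocycle C 2 :=
  Cocycle (deformation_cochain_cocycle D).

Lemma deformation_cocycle_surj (z : cocycle C 2) :
  exists D, deformation_cocycle D = z.
Proof.
have /asboolP[Tz dz] := cocycleP z.
have Ez := cochain_deformation_dataK Tz.
have L : deformation_laws (cochain_deformation_data z).
  by apply/deformation_lawsP; rewrite Ez.
by exists (Deformation L); apply: val_inj.
Qed.

Local Notation H := (Quotient.quot (@is_coboundary K C 2)).
Local Open Scope quotient_scope.

(** A coboundary is exactly what the quotient identifies with zero. Being an equality of classes,
    ψ-equivalence is reflexive, symmetric and transitive. *)
Lemma psi_equivalent_pi D D' : psi_equivalent D D' <->
  \pi_H (deformation_cocycle D') = \pi_H (deformation_cocycle D).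
Proof.
apply: iff_trans (psi_equivalentP D D') _.
split=> [dy | /eqP]; last by rewrite -Quotient.idealrBE => /asboolP.
by apply/eqP; rewrite -Quotient.idealrBE; apply/asboolP.
Qed.

End Classification.

Theorem theorem8p6 (K : comPzRingType) (C : gray_semigroup K) :
  exists F : psi_class C -> H_tens_ass C 2, bijective F.
Proof.
pose H := Quotient.quot (@is_coboundary K C 2).
(* A class is a predicate known only to have some representative, so one is chosen. *)
pose rep (A : psi_class C) := projT1 (cid (svalP A)).
have repE A : sval A = psi_equivalent (rep A) := projT2 (cid (svalP A)).
pose F (A : psi_class C) : H_tens_ass C 2 := (\pi_H (deformation_cocycle (rep A)))%qT.
pose cls D : psi_class C := exist _ (psi_equivalent D) (ex_intro _ D erefl).
have eqv D D' : psi_equivalent D D' -> psi_equivalent D = psi_equivalent D'.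
  move=> /psi_equivalent_pi E; apply/funext => D''; apply/propext.
  by split=> /psi_equivalent_pi E'; apply/psi_equivalent_pi; rewrite E' E.
have Finj : injective F.
  move=> A B E; have: sval A = sval B.
    by rewrite !repE; apply/eqv/psi_equivalent_pi.
  by case: A B {E} => [A pA] [B pB] /= ?; subst B; apply: eq_exist.
have Fsurj z : exists A, F A = z.
  have [D ED] := deformation_cocycle_surj (repr z).
  exists (cls D); rewrite -[z]reprK -ED; apply/psi_equivalent_pi.
  (* The representative chosen for the class of [D] may differ from [D], but it defines the same
     predicate, so reflexivity suffices. *)
  by rewrite (repE (cls D) : psi_equivalent D = _); apply/psi_equivalent_pi.
(* A section of the surjection is a right inverse, and injectivity makes it two-sided. *)
have [G GK] := choice Fsurj.
by exists F, G => // A; apply: Finj.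
Qed.
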